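(* For all $\Gamma\subseteq\{0,1\}^\infty$, $$\mathrm{Dim}(\Gamma)=\inf \mathscr G^{\mathrm{str}}_{\mathrm{constr}}(\Gamma),$$ where $\mathrm{Dim}(\Gamma)$ is the algorithmic strong dimension of $\Gamma$ and $\mathscr G^{\mathrm{str}}_{\mathrm{constr}}(\Gamma)=\{s\in[0,\infty) : \text{there exists a learning function } l \text{ which strongly algorithmically } s\text{-learns every } X\in\Gamma\}$.
   Context: For $s\in[0,\infty)$, an $s$-gale is a function $d:\{0,1\}^*\to[0,\infty)$ with $d(w)2^{-s|w|}=d(w0)2^{-s(|w|+1)}+d(w1)2^{-s(|w|+1)}$ for all $w$. A function $f:\{0,1\}^*\to[0,\infty)$ is lower semicomputable if there is a computable $g:\{0,1\}^*\times\mathbb N\to\mathbb Q\cap[0,\infty)$ with $g(w,t)\le g(w,t+1)\le f(w)$ and $\lim_t g(w,t)=f(w)$. A gale $d$ succeeds strongly on $X$ if $\liminf_n d(X\upharpoonright n)=\infty$. The algorithmic strong dimension is $\mathrm{Dim}(\Gamma)=\inf\{s\in[0,\infty): \text{some lower semicomputable } s\text{-gale succeeds strongly on every } X\in\Gamma\}$. A learning function is a function $l:\{0,1\}^*\to\{0,1\}$ (yes $=1$, no $=0$). $Y\upharpoonright i$ is the length-$i$ prefix of $Y$; $\lambda$ is the uniform (Lebesgue) measure on $\{0,1\}^\infty$. For nonempty $w$, $\mathrm{AVG}_l(w)=\frac{1}{|w|}\sum_{i=0}^{|w|} l(w\upharpoonright i)$. For $s\ge 0$, $l$ strongly algorithmically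 $s$-learns $X$ iff: (1) the map $w\mapsto \mathrm{AVG}_l(w)$ is lower semicomputable (uniformly in $w$); (2) for all $n\in\mathbb N$, $\lambda(\{Y : \#\{i\in\mathbb N: l(Y\upharpoonright i)=1\}\ge n\})\le 2^{-n}$; (3) $\liminf_{n\to\infty}\mathrm{AVG}_l(X\upharpoonright n)\ge 1-s$. *)

(* Defs.v *)
From HB Require Import structures.
From mathcomp Require Import all_boot all_order all_algebra.
From mathcomp Require Import all_classical all_reals all_analysis.
Set Implicit Arguments. Unset Strict Implicit. Unset Printing Implicit Defensive.
Import Order.TTheory GRing.Theory Num.Theory.
Import numFieldNormedType.Exports.
Local Open Scope classical_set_scope.
Local Open Scope ring_scope.

Inductive prf : Type :=
| PZero | PSucc | PProj of nat | PComp of prf & list prf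
| PPrim of prf & prf | PMu of prf.

Inductive eval : prf -> seq nat -> nat -> Prop :=
| evZero v : eval PZero v 0
| evSucc x v : eval PSucc (x :: v) x.+1
| evProj i v : (i < size v)%N -> eval (PProj i) v (nth 0%N v i)
| evComp f gs v ys y : evals gs v ys -> eval f ys y -> eval (PComp f gs) v y
| evPrim0 f g v y : eval f v y -> eval (PPrim f g) (0%N :: v) y
| evPrimS f g x v r y : eval (PPrim f g) (x :: v) r ->
    eval g (x :: r :: v) y -> eval (PPrim f g) (x.+1 :: v) y
| evMu f v y : eval f (y :: v) 0%N ->
    (forall z, (z < y)%N -> exists2 r, eval f (z :: v) r & r <> 0%N) ->
    eval (PMu f) v y
with evals : list prf -> seq nat -> seq nat -> Prop :=
| evsNil v : evals [::] v [::]
| evsCons g gs v y ys : eval g v y -> evals gs v ys -> evals (g :: gs) v (y :: ys).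

(* g : {0,1}^* x N -> Q is computable, via the standard (computable,
   injective) codings [pickle] of binary strings and of rationals. *)
Definition computable_wn_rat (g : seq bool -> nat -> rat) : Prop :=
  exists c : prf, forall w t, eval c [:: pickle w; t] (pickle (g w t)).

Definition lower_semicomputable {R : realType} (f : seq bool -> R) : Prop :=
  exists g : seq bool -> nat -> rat,
    [/\ computable_wn_rat g,
        (forall w t, 0 <= g w t),
        (forall w t, g w t <= g w t.+1),
        (forall w t, ratr (g w t) <= f w)
      & (forall w, (fun t => ratr (g w t) : R) @ \oo --> f w)].

Definition prefix (X : nat -> bool) (n : nat) : seq bool := mkseq X n.

Definition is_gale {R : realType} (s : R) (d : seq bool -> R) : Prop :=
  (forall w, 0 <= d w) /\
  forall w, d w * powR 2 (- (s * (size w)%:R)) =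
            d (rcons w false) * powR 2 (- (s * (size w).+1%:R)) +
            d (rcons w true) * powR 2 (- (s * (size w).+1%:R)).

Definition succeeds_strongly {R : realType} (d : seq bool -> R) (X : nat -> bool) :=
  limn_einf (fun n => (d (prefix X n))%:E) = +oo%E.

Definition Dim {R : realType} (Gamma : set (nat -> bool)) : R :=
  inf [set s : R | 0 <= s /\
        exists d : seq bool -> R, [/\ lower_semicomputable d, is_gale s d &
                                      forall X, Gamma X -> succeeds_strongly d X]].

Definition cyl (w : seq bool) : set (nat -> bool) :=
  [set Y | prefix Y (size w) = w].

(* The uniform measure, as the (Caratheodory) outer measure generated by
   cylinders with lambda([w]) = 2^-|w|; it coincides with lambda on all
   Borel sets. *)
Definition lambda {R : realType} (A : set (nat -> bool)) : \bar R :=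
  ereal_inf [set x : \bar R | exists ws : nat -> seq bool,
      A `<=` \bigcup_k cyl (ws k) /\
      x = (\sum_(0 <= k <oo) (((2:R) ^- size (ws k))%:E))%E].

(* AVG_l(w) = (1/|w|) sum_{i=0}^{|w|} l(w|i) ; (value 0 at w = empty, where
   it is undefined in the paper) *)
Definition AVG {R : realType} (l : seq bool -> bool) (w : seq bool) : R :=
  (\sum_(i < (size w).+1) ((l (take i w) : nat)%:R)) / (size w)%:R.

Definition many_yes (l : seq bool -> bool) (n : nat) : set (nat -> bool) :=
  [set Y | exists s : seq nat,
      [/\ uniq s, size s = n & all (fun i => l (prefix Y i)) s]].

Definition strongly_learns {R : realType} (s : R) (l : seq bool -> bool)
    (X : nat -> bool) : Prop :=
  [/\ lower_semicomputable (AVG (R:=R) l),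
      (forall n : nat, (lambda (R:=R) (many_yes l n) <= ((2:R) ^- n)%:E)%E)
    & ((1 - s)%:E <= limn_einf (fun n => (AVG (R:=R) l (prefix X n))%:E))%E].

Definition G_str_constr {R : realType} (Gamma : set (nat -> bool)) : set R :=
  [set s : R | 0 <= s /\
     exists l : seq bool -> bool, forall X, Gamma X -> strongly_learns s l X].

(* Main.v *)
Require Import Defs.
From HB Require Import structures.
From mathcomp Require Import all_boot all_order all_algebra.
From mathcomp Require Import all_classical all_reals all_analysis.
From mathcomp Require Import zify ring lra.
Set Implicit Arguments. Unset Strict Implicit. Unset Printing Implicit Defensive.
Import Order.TTheory GRing.Theory Num.Theory.
Import numFieldNormedType.Exports.
Import Defs.

(** Both inequalities pass through exponents [s'] such that [2 `^ s'] is
rational, so that every comparison needed by an approximation is a comparison of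
natural numbers.

From gales to learners: if [d] is an [s]-gale and [s < s'], then [m w := d w * 2
`^ ((1 - s') * size w)] is a supermartingale up to a constant, so [m] at most
doubles at each bit. The largest [k] such that [m] has exceeded [2 ^+ k] along
the prefixes of [w] therefore grows by at most one per bit, and is the number of
"yes" answers of a learner. Lower semicomputability is only required of the
averages, i.e. of this level, not of the learner itself. Doob's maximal
inequality bounds the measure of the sequences reaching level [n].

From learners to gales: let [U_k] be the set of sequences with at least [k]
"yes" answers. Since its measure is at most [2 ^- k], the sum of [rho ^+ k]
times the conditional measure of [U_k] is a finite martingale whenever [rho <
2], and it is at least [rho ^+ k] on a string already showing [k] "yes" answers.
With [rho] close to [2], multiplying it by [2 `^ ((s' - 1) * size w)] gives an
[s']-gale succeeding strongly on every sequence that is [s]-learned. *)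

(** * Closure properties of computable functions *)

(* A context of arguments: each component is passed to a program through its
   [pickle] code, the most recently added one first. *)
Record env := Env {
  env_sort :> Type;
  env_code : env_sort -> seq nat;
  env_size : nat;
  size_env_code : forall x, size (env_code x) = env_size }.

Definition env_nil : env := @Env unit (fun=> [::]) 0 (fun=> erefl).

Definition env_cons_code (E : env) (T : countType) (p : E * T) :=
  pickle p.2 :: env_code p.1.

Lemma size_env_cons (E : env) (T : countType) (p : E * T) :
  size (env_cons_code p) = (env_size E).+1.
Proof. by rewrite /= size_env_code. Qed.

Definition env_cons (E : env) (T : countType) : env := Env (@size_env_cons E T).

Definition computable (E : env) (T : countType) (f : E -> T) : Prop :=
  exists c : prf, forall x, eval c (env_code x) (pickle (f x)).

Definition computable1 (A T : countType) (f : A -> T) :=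
  @computable (env_cons env_nil A) T (fun p => f p.2).
Definition computable2 (A B T : countType) (f : A -> B -> T) :=
  @computable (env_cons (env_cons env_nil B) A) T (fun p => f p.2 p.1.2).

Lemma eq_comp (E : env) (T : countType) (f g : E -> T) :
  f =1 g -> computable f -> computable g.
Proof. by move=> fg [c cP]; exists c => x; rewrite -fg. Qed.

Section Basic.
Variable E : env.

Lemma comp_var0 (T : countType) : @computable (env_cons E T) T (fun p => p.2).
Proof. by exists (PProj 0) => p; exact: (@evProj 0 (_ :: _)). Qed.

Lemma comp_var1 (T T1 : countType) :
  @computable (env_cons (env_cons E T) T1) T (fun p => p.1.2).
Proof. by exists (PProj 1) => p; exact: (@evProj 1 (_ :: _ :: _)). Qed.

Lemma comp_var2 (T T1 T2 : countType) :
  @computable (env_cons (env_cons (env_cons E T) T1) T2) T (fun p => p.1.1.2).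
Proof. by exists (PProj 2) => p; exact: (@evProj 2 (_ :: _ :: _ :: _)). Qed.

Lemma comp_var3 (T T1 T2 T3 : countType) :
  @computable (env_cons (env_cons (env_cons (env_cons E T) T1) T2) T3) T
        (fun p => p.1.1.1.2).
Proof. by exists (PProj 3) => p; exact: (@evProj 3 (_ :: _ :: _ :: _ :: _)). Qed.

Lemma comp_var4 (T T1 T2 T3 T4 : countType) :
  @computable (env_cons (env_cons (env_cons (env_cons (env_cons E T) T1) T2) T3) T4)
        T (fun p => p.1.1.1.1.2).
Proof.
by exists (PProj 4) => p; exact: (@evProj 4 (_ :: _ :: _ :: _ :: _ :: _)).
Qed.

Lemma comp_app1 (A T : countType) (f : A -> T) (a : E -> A) :
  computable1 f -> computable a -> computable (fun x => f (a x)).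
Proof.
move=> [c cP] [ca caP]; exists (PComp c [:: ca]) => x.
apply: evComp (cP (tt, a x)); apply: evsCons (caP x) _; exact: evsNil.
Qed.

Lemma comp_app2 (A B T : countType) (f : A -> B -> T) (a : E -> A) (b : E -> B) :
  computable2 f -> computable a -> computable b -> computable (fun x => f (a x) (b x)).
Proof.
move=> [c cP] [ca caP] [cb cbP]; exists (PComp c [:: ca; cb]) => x.
apply: evComp (cP ((tt, b x), a x)).
apply: evsCons (caP x) _; apply: evsCons (cbP x) _; exact: evsNil.
Qed.

Lemma comp_const_nat (n : nat) : @computable E nat (fun=> n).
Proof.
elim: n => [|n [c cP]]; first by exists PZero => x; exact: evZero.
exists (PComp PSucc [:: c]) => x; apply: evComp (evSucc n [::]).
apply: evsCons (cP x) _; exact: evsNil.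
Qed.

Lemma comp_const (T : countType) (y : T) : @computable E T (fun=> y).
Proof. by have [c cP] := comp_const_nat (pickle y); exists c. Qed.

(** [pickle] is the identity on [nat], so both sides ask for the same program. Functions into any
    countable type can thus be built by arithmetic on codes. *)
Lemma comp_pickle (T : countType) (f : E -> T) :
  computable f <-> @computable E nat (fun x => pickle (f x)).
Proof. by []. Qed.

(** Projections copy a tail of the argument list, which is how a program hands its environment over
    to a subprogram. *)
Lemma evals_projs (v : seq nat) k m : (k + m = size v)%N ->
  evals [seq PProj i | i <- iota k m] v (drop k v).
Proof.
elim: m k => [|m IH] k kmv /=.
  by rewrite drop_oversize ?evsNil -?kmv ?addn0 //; exact: evsNil.
have kv : (k < size v)%N by rewrite -kmv addnS ltnS leq_addr.
rewrite (drop_nth 0%N kv); apply: evsCons; first exact: evProj.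
by apply: IH; rewrite addSnnS.
Qed.

Lemma comp_weak (T T1 : countType) (f : E -> T) :
  computable f -> @computable (env_cons E T1) T (fun z => f z.1).
Proof.
move=> [c cP]; exists (PComp c [seq PProj i | i <- iota 1 (env_size E)]) => z.
apply: (@evComp _ _ _ (env_code z.1)); last exact: cP.
have := @evals_projs (env_code z) 1 (env_size E).
by rewrite /= drop0; apply; rewrite size_env_code.
Qed.

Fixpoint natrec (a : nat) (h : nat -> nat -> nat) (n : nat) : nat :=
  if n is m.+1 then h m (natrec a h m) else a.

Lemma comp_natrec (a : E -> nat) (h : E -> nat -> nat -> nat) (n : E -> nat) :
  computable n -> computable a ->
  @computable (env_cons (env_cons E nat) nat) nat (fun p => h p.1.1 p.2 p.1.2) ->
  @computable E nat (fun x => natrec (a x) (h x) (n x)).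
Proof.
move=> [cn cnP] [ca caP] [ch chP].
exists (PComp (PPrim ca ch) (cn :: [seq PProj i | i <- iota 0 (env_size E)])) => x.
apply: (@evComp _ _ _ (n x :: env_code x)).
  apply: evsCons (cnP x) _; rewrite -[X in evals _ _ X]drop0.
  by apply: evals_projs; rewrite add0n size_env_code.
elim: (n x) => [|m IH] /=; first by apply: evPrim0; exact: caP.
apply: evPrimS IH _; exact: (chP ((x, _), _)).
Qed.

End Basic.

Ltac comp_var := solve [ exact: comp_var0 | exact: comp_var1 | exact: comp_var2
  | exact: comp_var3 | exact: comp_var4 | exact: comp_weak ].

(** * Arithmetic and Boolean operations on natural numbers *)

Lemma computable1_succ : @computable1 nat nat succn.
Proof. by exists PSucc => -[[] n]; exact: evSucc. Qed.

Lemma computable2_add : @computable2 nat nat nat addn.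
Proof.
have : @computable (env_cons (env_cons env_nil nat) nat) nat
    (fun p => natrec p.1.2 (fun _ r => r.+1) p.2).
  apply: (@comp_natrec (env_cons (env_cons env_nil nat) nat) (fun p => p.1.2) (fun _ _ r => r.+1)); try comp_var.
  by apply: (comp_app1 computable1_succ); comp_var.
by apply: eq_comp => -[[[] b] a] /=; elim: a => //= a ->.
Qed.

Lemma computable2_mul : @computable2 nat nat nat muln.
Proof.
have : @computable (env_cons (env_cons env_nil nat) nat) nat
    (fun p => natrec 0 (fun _ r => p.1.2 + r) p.2).
  apply: (@comp_natrec (env_cons (env_cons env_nil nat) nat) (fun p => 0) (fun p _ r => p.1.2 + r)); try comp_var.
    exact: comp_const_nat.
  by apply: (comp_app2 computable2_add); comp_var.
by apply: eq_comp => -[[[] b] a] /=; elim: a => //= a ->.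
Qed.

Lemma computable1_pred : @computable1 nat nat predn.
Proof.
have : @computable (env_cons env_nil nat) nat
    (fun p => natrec 0 (fun m r => m) p.2).
  apply: (@comp_natrec (env_cons env_nil nat) (fun p => 0) (fun p m r => m)); try comp_var.
  exact: comp_const_nat.
by apply: eq_comp => -[[] [|a]].
Qed.

Lemma computable2_sub : @computable2 nat nat nat subn.
Proof.
have : @computable (env_cons (env_cons env_nil nat) nat) nat
    (fun p => natrec p.2 (fun _ r => r.-1) p.1.2).
  apply: (@comp_natrec (env_cons (env_cons env_nil nat) nat) (fun p => p.2) (fun _ _ r => r.-1)); try comp_var.
  by apply: (comp_app1 computable1_pred); comp_var.
by apply: eq_comp => -[[[] b] a] /=; elim: b => [|b /= ->]; rewrite ?subn0 ?subnS.
Qed.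

Lemma computable2_exp : @computable2 nat nat nat expn.
Proof.
have : @computable (env_cons (env_cons env_nil nat) nat) nat
    (fun p => natrec 1 (fun _ r => p.2 * r) p.1.2).
  apply: (@comp_natrec (env_cons (env_cons env_nil nat) nat) (fun p => 1) (fun p _ r => p.2 * r)); try comp_var.
    exact: comp_const_nat.
  by apply: (comp_app2 computable2_mul); comp_var.
by apply: eq_comp => -[[[] b] a] /=; elim: b => //= b ->; rewrite expnS.
Qed.

Lemma pickle_bool (b : bool) : pickle b = b. Proof. by case: b. Qed.

Section Operations.
Variable E : env.
Implicit Types (a b n : E -> nat) (p q : E -> bool).

Lemma comp_succ a : computable a -> @computable E nat (fun x => (a x).+1).
Proof. exact: comp_app1 computable1_succ. Qed.
Lemma comp_add a b : computable a -> computable b -> @computable E nat (fun x => a x + b x).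
Proof. exact: comp_app2 computable2_add. Qed.
Lemma comp_mul a b : computable a -> computable b -> @computable E nat (fun x => a x * b x).
Proof. exact: comp_app2 computable2_mul. Qed.
Lemma comp_sub a b : computable a -> computable b -> @computable E nat (fun x => a x - b x).
Proof. exact: comp_app2 computable2_sub. Qed.
Lemma comp_exp a b : computable a -> computable b -> @computable E nat (fun x => a x ^ b x).
Proof. exact: comp_app2 computable2_exp. Qed.

Lemma comp_bool p : computable p <-> @computable E nat (fun x => p x : nat).
Proof.
by split; move=> [c cP]; exists c => x; have := cP x; rewrite pickle_bool.
Qed.

Lemma comp_leq a b : computable a -> computable b -> @computable E bool (fun x => a x <= b x).
Proof.
move=> ca cb; apply/comp_bool.
apply: (@eq_comp _ _ (fun x => 1 - (a x - b x))).
  by move=> x; rewrite -subn_eq0; case: (a x - b x).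
by apply: comp_sub; [exact: comp_const | exact: comp_sub].
Qed.

Lemma comp_ltn a b : computable a -> computable b -> @computable E bool (fun x => a x < b x).
Proof. by move=> ca cb; apply: comp_leq cb; exact: comp_succ. Qed.

Lemma comp_not p : computable p -> @computable E bool (fun x => ~~ p x).
Proof.
move=> cp; apply/comp_bool; apply: (@eq_comp _ _ (fun x => 1 - p x)).
  by move=> x; case: (p x).
by apply: comp_sub; [exact: comp_const | exact/comp_bool].
Qed.

Lemma comp_and p q : computable p -> computable q -> @computable E bool (fun x => p x && q x).
Proof.
move=> cp cq; apply/comp_bool; apply: (@eq_comp _ _ (fun x => p x * q x)).
  by move=> x; rewrite mulnb.
by apply: comp_mul; apply/comp_bool.
Qed.

Lemma comp_if (T : countType) p (f g : E -> T) : computable p -> computable f -> computable g ->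
  @computable E T (fun x => if p x then f x else g x).
Proof.
move=> cp cf cg; apply/comp_pickle.
apply: (@eq_comp _ _ (fun x => p x * pickle (f x) + (~~ p x) * pickle (g x))).
  by move=> x; case: (p x); rewrite ?mul1n ?mul0n ?addn0.
apply: comp_add; apply: comp_mul => //; apply/comp_bool => //.
exact: comp_not.
Qed.

Lemma comp_eqn a b : computable a -> computable b -> @computable E bool (fun x => a x == b x).
Proof.
move=> ca cb; apply: (@eq_comp _ _ (fun x => (a x <= b x) && (b x <= a x))).
  by move=> x; rewrite eqn_leq.
by apply: comp_and; apply: comp_leq.
Qed.

End Operations.

(** * Bounded sums, bounded quantifiers and division *)

Lemma comp_sum (E : env) (n : E -> nat) (F : E -> nat -> nat) : computable n ->
  @computable (env_cons E nat) nat (fun z => F z.1 z.2) ->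
  @computable E nat (fun x => \sum_(i < n x) F x i).
Proof.
move=> cn [c cP].
have step : @computable (env_cons (env_cons E nat) nat) nat
    (fun z => z.1.2 + F z.1.1 z.2).
  apply: comp_add; first comp_var.
  (* The index is argument 0 and the accumulator argument 1. The program for [F] must not see the
     accumulator, so the environment is read from position 2. *)
  exists (PComp c (PProj 0 :: [seq PProj i | i <- iota 2 (env_size E)])) => z.
  apply: (@evComp _ _ _ (env_cons_code (E := E) (z.1.1, z.2))); last exact: cP.
  apply: evsCons; first exact: (@evProj 0 (_ :: _)).
  have := @evals_projs (env_code z) 2 (env_size E).
  by rewrite /= drop0; apply; rewrite size_env_code.
have := @comp_natrec E (fun=> 0) (fun x i r => r + F x i) n cn
  (comp_const E (0 : nat)) step.
by apply: eq_comp => x; elim: (n x) => [|m IH]; rewrite ?big_ord0 // big_ord_recr /= IH.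
Qed.

Lemma comp_exists (E : env) (n : E -> nat) (P : E -> nat -> bool) : computable n ->
  @computable (env_cons E nat) bool (fun z => P z.1 z.2) ->
  @computable E bool (fun x => [exists i : 'I_(n x), P x i]).
Proof.
move=> cn /comp_bool cP.
have := comp_ltn (comp_const E (0 : nat)) (@comp_sum _ _ (fun x i => P x i : nat) cn cP).
apply: eq_comp => x; rewrite lt0n sum_nat_eq0 negb_forall.
by apply: eq_existsb => i; rewrite /= eqb0 negbK.
Qed.

(** Quotients, 2-adic valuations and lengths are all computed as the number of indices below them;
    this evaluates such counts once the range of summation is large enough. *)
Lemma sum_ltn_minn n m : \sum_(i < n) (i < m : nat) = minn n m.
Proof.
elim: n => [|n IH]; first by rewrite big_ord0 min0n.
by rewrite big_ord_recr /= IH; case: ltnP; lia.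
Qed.

(** The quotient counts the [i < a] with [i.+1 * b <= a]. The test [0 < b] matches the convention
    that division by zero gives zero. *)
Lemma comp_div (E : env) (a b : E -> nat) :
  computable a -> computable b -> @computable E nat (fun x => a x %/ b x).
Proof.
move=> ca cb.
have cP : @computable (env_cons E nat) bool
    (fun z => (0 < b z.1) && (z.2.+1 * b z.1 <= a z.1)).
  apply: comp_and; first by apply: comp_ltn; [exact: comp_const | comp_var].
  by apply: comp_leq; first apply: comp_mul; first apply: comp_succ; comp_var.
have /comp_bool cP' := cP.
apply: eq_comp _ (@comp_sum _ a (fun x i => (0 < b x) && (i.+1 * b x <= a x) : nat) ca cP').
move=> x /=; have [->|b0] := posnP (b x); first by rewrite divn0 big1.
under eq_bigr => i _ do rewrite -leq_divRL //.
by rewrite sum_ltn_minn; apply/minn_idPr; exact: leq_div.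
Qed.

Lemma comp_dvd (E : env) (a b : E -> nat) :
  computable a -> computable b -> @computable E bool (fun x => a x %| b x).
Proof.
move=> ca cb; apply: eq_comp _ (comp_eqn (comp_mul (comp_div cb ca) ca) cb) => x.
by rewrite dvdn_eq.
Qed.

Lemma comp_odd (E : env) (a : E -> nat) :
  computable a -> @computable E bool (fun x => odd (a x)).
Proof.
move=> ca; apply: eq_comp _ (comp_not (comp_dvd (comp_const E (2 : nat)) ca)) => x.
by rewrite dvdn2 negbK.
Qed.

(* [CodeSeq.code (n :: s)] is [2 ^ n * (2 * CodeSeq.code s).+1], so the head of a
   coded sequence is a 2-adic valuation. *)
Definition code_head (c : nat) : nat := \sum_(i < c) (2 ^ i.+1 %| c : nat).
Definition code_tail (c : nat) : nat := c %/ 2 ^ (code_head c).+1.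

Lemma code_head_cons n s : code_head (CodeSeq.code (n :: s)) = n.
Proof.
rewrite /code_head /=; set c := CodeSeq.code s.
have c0 : 0 < 2 ^ n * c.*2.+1 by rewrite muln_gt0 expn_gt0.
have dv (i : nat) : (2 ^ i.+1 %| 2 ^ n * c.*2.+1) = (i < n).
  have [lin|lni] := ltnP i n; first by rewrite dvdn_mulr // dvdn_exp2l.
  apply/negP => /(dvdn_trans (dvdn_exp2l 2 (lni : n < i.+1))).
  by rewrite expnSr dvdn_pmul2l ?expn_gt0 // dvdn2 /= odd_double.
under eq_bigr => i _ do rewrite dv.
rewrite sum_ltn_minn; apply/minn_idPr.
by rewrite (leq_trans (ltnW (ltn_expl n (ltnSn 1)))) // leq_pmulr.
Qed.

Lemma code_tail_cons n s : code_tail (CodeSeq.code (n :: s)) = CodeSeq.code s.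
Proof.
rewrite /code_tail code_head_cons /= expnSr divnMl ?expn_gt0 //.
by rewrite divn2 /= uphalf_double.
Qed.

Lemma code_head0 : code_head 0 = 0. Proof. by rewrite /code_head big_ord0. Qed.
Lemma code_tail0 : code_tail 0 = 0. Proof. by rewrite /code_tail div0n. Qed.

Lemma comp_code_head (E : env) (a : E -> nat) :
  computable a -> @computable E nat (fun x => code_head (a x)).
Proof.
move=> ca; apply: (@comp_sum _ _ (fun x i => 2 ^ i.+1 %| a x : nat)) => //.
apply/(comp_bool (fun z : env_cons E nat => 2 ^ z.2.+1 %| a z.1))/comp_dvd; last comp_var.
by apply: comp_exp; [exact: comp_const | apply: comp_succ; comp_var].
Qed.

Lemma comp_code_tail (E : env) (a : E -> nat) :
  computable a -> @computable E nat (fun x => code_tail (a x)).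
Proof.
move=> ca; apply: comp_div => //; apply: comp_exp; first exact: comp_const.
exact/comp_succ/comp_code_head.
Qed.

Lemma comp_code_drop (E : env) (a n : E -> nat) : computable a -> computable n ->
  @computable E nat (fun x => iter (n x) code_tail (a x)).
Proof.
move=> ca cn; have st : @computable (env_cons (env_cons E nat) nat) nat (fun z => code_tail z.1.2).
  by apply: comp_code_tail; comp_var.
apply: eq_comp _ (@comp_natrec _ a (fun _ _ r => code_tail r) n cn ca st).
by move=> x; elim: (n x) => //= k ->.
Qed.

Lemma code_drop s i : iter i code_tail (CodeSeq.code s) = CodeSeq.code (drop i s).
Proof.
elim: i s => [|i IH] s; first by rewrite drop0.
case: s => [|n s]; last by rewrite iterSr code_tail_cons IH.
by rewrite iterSr code_tail0 (IH [::]) !drop_oversize.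
Qed.

(** * Computable operations on binary strings *)

Lemma pickle_bits (w : seq bool) : pickle w = CodeSeq.code (map nat_of_bool w).
Proof. by congr CodeSeq.code; apply: eq_map => b; exact: pickle_bool. Qed.

Lemma code_eq0 s : (CodeSeq.code s == 0) = (s == [::]).
Proof. by case: s => //= n s; rewrite muln_eq0 expn_eq0. Qed.

Lemma size_leq_code s : size s <= CodeSeq.code s.
Proof.
elim: s => //= n s IH; rewrite (@leq_trans (CodeSeq.code s).*2.+1) //.
  by rewrite ltnS (leq_trans IH) // -addnn leq_addr.
by rewrite leq_pmull // expn_gt0.
Qed.

(** Only the empty sequence has code 0, so the length is the number of [i] for which the [i]-fold
    tail has a nonzero code; the code itself bounds the search. *)
Lemma comp_size (E : env) (w : E -> seq bool) :
  computable w -> @computable E nat (fun x => size (w x)).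
Proof.
move=> /comp_pickle cw.
have /comp_bool st : @computable (env_cons E nat) bool (fun z => 0 < iter z.2 code_tail (pickle (w z.1))).
  apply: comp_ltn; first exact: comp_const.
  by apply: comp_code_drop; first apply: (comp_weak (f := fun x => pickle (w x)) nat); [|comp_var].
apply: eq_comp _ (@comp_sum _ _ (fun x i => 0 < iter i code_tail (pickle (w x)) : nat) cw st).
move=> x /=; rewrite pickle_bits.
under eq_bigr => i _.
  rewrite code_drop lt0n code_eq0 -size_eq0 size_drop subn_eq0 -ltnNge size_map.
  over.
rewrite sum_ltn_minn; apply/minn_idPr.
by rewrite -[X in X <= _](size_map nat_of_bool) size_leq_code.
Qed.

Lemma comp_nth (E : env) (w : E -> seq bool) (i : E -> nat) :
  computable w -> computable i -> @computable E bool (fun x => nth false (w x) (i x)).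
Proof.
move=> /comp_pickle cw ci; apply/comp_bool.
apply: eq_comp _ (comp_code_head (comp_code_drop cw ci)) => x.
rewrite pickle_bits code_drop; have [iw|wi] := ltnP (i x) (size (w x)).
  rewrite (drop_nth 0) ?size_map // code_head_cons.
  by rewrite (nth_map false).
by rewrite drop_oversize ?size_map ?nth_default ?code_head0.
Qed.

(** Coding builds a sequence by prepending heads, so the recursion runs from the last entry to the
    first: after [k] steps the accumulator is the code of the last [k] entries. *)
Lemma comp_mkseq (E : env) (n : E -> nat) (F : E -> nat -> bool) : computable n ->
  @computable (env_cons E nat) bool (fun z => F z.1 z.2) ->
  @computable E (seq bool) (fun x => mkseq (F x) (n x)).
Proof.
move=> cn cF; apply/comp_pickle.
have st : @computable (env_cons (env_cons E nat) nat) nat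
    (fun z => 2 ^ F z.1.1 (n z.1.1 - z.2.+1) * (z.1.2 * 2).+1).
  apply: comp_mul; last first.
    apply: comp_succ; apply: comp_mul; [comp_var | exact: comp_const].
  apply: comp_exp; first exact: comp_const; apply/comp_bool.
  have /comp_bool [c cP] := cF.
  have [d dP] : @computable (env_cons (env_cons E nat) nat) nat (fun z => n z.1.1 - z.2.+1).
    apply: comp_sub; last by apply: comp_succ; comp_var.
    by apply: (@comp_weak (env_cons E nat) nat nat (fun z => n z.1)); exact: comp_weak.
  exists (PComp c (d :: [seq PProj i | i <- iota 2 (env_size E)])) => z.
  apply: (@evComp _ _ _ (env_cons_code (E := E) (z.1.1, n z.1.1 - z.2.+1))).
    apply: evsCons; first exact: dP.
    have := @evals_projs (env_code z) 2 (env_size E).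
    by rewrite /= drop0; apply; rewrite size_env_code.
  exact: (cP (z.1.1, n z.1.1 - z.2.+1)).
apply: eq_comp _ (@comp_natrec _ (fun=> 0)
  (fun x j r => 2 ^ F x (n x - j.+1) * (r * 2).+1) n cn (comp_const E (0 : nat)) st) => x.
suff H k : k <= n x ->
    natrec 0 (fun j r => 2 ^ F x (n x - j.+1) * (r * 2).+1) k =
    CodeSeq.code [seq nat_of_bool (F x i) | i <- iota (n x - k) k].
  by rewrite H // subnn pickle_bits -map_comp.
elim: k => [|k IH] kn //=; rewrite IH 1?ltnW // muln2.
by rewrite subnSK.
Qed.

Lemma comp_take (E : env) (n : E -> nat) (w : E -> seq bool) :
  computable n -> computable w -> @computable E (seq bool) (fun x => take (n x) (w x)).
Proof.
move=> cn cw; have cm : @computable E nat (fun x => if n x <= size (w x) then n x else size (w x)).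
  by apply: comp_if => //; [apply: comp_leq => // |]; exact: comp_size.
have cF : @computable (env_cons E nat) bool (fun z => nth false (w z.1) z.2).
  by apply: comp_nth; comp_var.
apply: eq_comp _ (@comp_mkseq _ _ (fun x i => nth false (w x) i) cm cF) => x; apply: (@eq_from_nth _ false).
  by rewrite size_mkseq size_take_min; case: leqP.
move=> i; rewrite size_mkseq => ik; rewrite nth_mkseq // nth_take // (leq_trans ik) //.
by case: (leqP (n x) _) => // /ltnW.
Qed.

Lemma comp_cat (E : env) (v w : E -> seq bool) :
  computable v -> computable w -> @computable E (seq bool) (fun x => v x ++ w x).
Proof.
move=> cv cw.
have cm : @computable E nat (fun x => size (v x) + size (w x)).
  by apply: comp_add; exact: comp_size.
have cF : @computable (env_cons E nat) bool (fun z => if z.2 < size (v z.1)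
    then nth false (v z.1) z.2 else nth false (w z.1) (z.2 - size (v z.1))).
  have cs : @computable (env_cons E nat) nat (fun z => size (v z.1)).
    by apply: comp_size; comp_var.
  apply: comp_if; first by apply: comp_ltn => //; comp_var.
    by apply: comp_nth; comp_var.
  by apply: comp_nth; [comp_var | apply: comp_sub => //; comp_var].
apply: eq_comp _ (@comp_mkseq _ _ (fun x i => if i < size (v x)
  then nth false (v x) i else nth false (w x) (i - size (v x))) cm cF) => x.
apply: (@eq_from_nth _ false); first by rewrite size_mkseq size_cat.
by move=> i; rewrite size_mkseq => ik; rewrite nth_mkseq // nth_cat.
Qed.

(** * Codes of integers and rationals *)

Lemma pickle_nat_int (n : nat) : pickle (n%:Z)%R = 2 ^ (2 ^ n) * 3.
Proof. by rewrite -[pickle _]/(CodeSeq.code [:: CodeSeq.code [:: n]; 0]) /= muln1. Qed.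

Lemma code_head_pickle_int (n : nat) : code_head (code_head (pickle (n%:Z)%R)) = n.
Proof.
by rewrite -[pickle _]/(CodeSeq.code [:: CodeSeq.code [:: n]; 0]) !code_head_cons.
Qed.

Lemma pickle_rat (q : rat) : pickle q = CodeSeq.code [:: pickle (numq q); pickle (denq q)].
Proof. by []. Qed.

Lemma comp_numq (E : env) (f : E -> rat) : computable f -> (forall x, 0 <= f x)%R ->
  @computable E nat (fun x => `|numq (f x)|)%N.
Proof.
move=> /comp_pickle cf f0.
apply: eq_comp _ (comp_code_head (comp_code_head (comp_code_head cf))) => x.
rewrite pickle_rat code_head_cons.
have : (0 <= numq (f x))%R by rewrite numq_ge0.
by case: (numq _) => // n _; rewrite code_head_pickle_int.
Qed.

Lemma comp_denq (E : env) (f : E -> rat) : computable f ->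
  @computable E nat (fun x => `|denq (f x)|)%N.
Proof.
move=> /comp_pickle cf.
apply: eq_comp _ (comp_code_head (comp_code_head (comp_code_head (comp_code_tail cf)))) => x.
rewrite pickle_rat code_tail_cons code_head_cons.
have : (0 <= denq (f x))%R by rewrite denq_ge0.
by case: (denq _) => // n _; rewrite code_head_pickle_int.
Qed.

(* Hence [gcdn a b] is the number of multiples of [b] among [a * i], [1 <= i <= b]. *)
Lemma dvdn_mul_gcd a b i : 0 < b -> (b %| a * i) = (b %/ gcdn a b %| i).
Proof.
move=> b0; have g0 : 0 < gcdn a b by rewrite gcdn_gt0 b0 orbT.
have ea := divnK (dvdn_gcdl a b); have eb := divnK (dvdn_gcdr a b).
rewrite -[X in X %| _]eb -[X in _ %| X * _]ea mulnAC dvdn_pmul2r // Gauss_dvdr //.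
by rewrite /coprime gcdnC -(eqn_pmul2r g0) muln_gcdl ea eb mul1n.
Qed.

Lemma comp_gcd (E : env) (a b : E -> nat) : computable a -> computable b ->
  (forall x, 0 < b x) ->
  @computable E nat (fun x => gcdn (a x) (b x)).
Proof.
move=> ca cb b0.
have /comp_bool cP : @computable (env_cons E nat) bool (fun z => b z.1 %| a z.1 * z.2.+1).
  by apply: comp_dvd; [|apply: comp_mul; [|apply: comp_succ]]; comp_var.
apply: eq_comp _ (@comp_sum _ b (fun x i => b x %| a x * i.+1 : nat) cb cP) => x.
have g0 : 0 < gcdn (a x) (b x) by rewrite gcdn_gt0 b0 orbT.
set g := gcdn _ _ in g0 *.
under eq_bigr do rewrite dvdn_mul_gcd // -/g.
have := divn_count_dvd (b x %/ g) (b x); rewrite big_add1 big_mkord /= => <-.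
rewrite -[X in X %/ _](divnK (dvdn_gcdr (a x) (b x))) mulKn //.
by rewrite divn_gt0 // dvdn_leq // dvdn_gcdr.
Qed.

(** A rational is coded through its reduced numerator and denominator, so the fraction has to be
    divided by a computed gcd before coding. *)
Lemma comp_rat (E : env) (a b : E -> nat) : computable a -> computable b ->
  @computable E rat (fun x => (a x)%:R / (b x)%:R)%R.
Proof.
move=> ca cb.
(* A zero denominator is replaced by the fraction 0 / 1, which has the same value by convention and
   keeps the denominator positive for [comp_gcd]. *)
have cb' : @computable E nat (fun x => if b x == 0 then 1 else b x).
  apply: comp_if => //; try exact: comp_const.
  by apply: comp_eqn => //; exact: comp_const.
have ca' : @computable E nat (fun x => if b x == 0 then 0 else a x).
  apply: comp_if => //; try exact: comp_const.
  by apply: comp_eqn => //; exact: comp_const.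
move: cb' ca'; set b' := fun x => if _ then 1 else _; set a' := fun x => if _ then 0 else _.
move=> cb' ca'; have b0 x : 0 < b' x by rewrite /b'; case: (posnP (b x)).
have cg := comp_gcd ca' cb' b0.
have cn : @computable E nat (fun x => a' x %/ gcdn (a' x) (b' x)) by exact: comp_div.
have cd : @computable E nat (fun x => b' x %/ gcdn (a' x) (b' x)) by exact: comp_div.
have cpi (c : E -> nat) : computable c -> @computable E nat (fun x => 2 ^ (2 ^ c x) * 3).
  move=> cc; apply: comp_mul; last exact: comp_const.
  by do 2 (apply: comp_exp; first exact: comp_const).
apply/comp_pickle.
have cfin : @computable E nat (fun x => 2 ^ (2 ^ (2 ^ (a' x %/ gcdn (a' x) (b' x))) * 3) *
  (2 ^ (2 ^ (2 ^ (b' x %/ gcdn (a' x) (b' x))) * 3) * 2).+1).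
  apply: comp_mul; first by apply: comp_exp; [exact: comp_const | exact: cpi].
  apply: comp_succ; apply: comp_mul; last exact: comp_const.
  by apply: comp_exp; [exact: comp_const | exact: cpi].
apply: eq_comp _ cfin => x.
have -> : ((a x)%:R / (b x)%:R = (a' x)%:R / (b' x)%:R :> rat)%R.
  by rewrite /a' /b'; case: eqP => // ->; rewrite invr0 mulr0 mul0r.
move: (a' x) (b' x) (b0 x) => n d d0 {ca cb a b a' b' ca' cb' b0 cg cn cd cpi}.
have g0 : 0 < gcdn n d by rewrite gcdn_gt0 d0 orbT.
have cop : coprime (n %/ gcdn n d) (d %/ gcdn n d).
  by rewrite /coprime -(eqn_pmul2r g0) muln_gcdl !divnK ?dvdn_gcdl ?dvdn_gcdr // mul1n.
have d'0 : 0 < d %/ gcdn n d by rewrite divn_gt0 // dvdn_leq // dvdn_gcdr.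
have -> : (n%:R / d%:R = (n %/ gcdn n d)%N%:Z%:Q / (d %/ gcdn n d)%N%:Z%:Q :> rat)%R.
  have := divnK (dvdn_gcdl n d); have := divnK (dvdn_gcdr n d).
  move: (n %/ _) (d %/ _) d'0 g0 => n' d'; move: (gcdn n d) => g d'0 g0 <- <-.
  by rewrite !natrM -mulf_div divff ?mulr1 // pnatr_eq0 -lt0n.
rewrite pickle_rat coprimeq_num // coprimeq_den //.
rewrite gtr0_sg ?ltz_nat // mul1r eqz_nat gtn_eqF // gtr0_norm ?ltz_nat //.
by rewrite [CodeSeq.code _]/= !pickle_nat_int muln1 -!muln2.
Qed.

Lemma lt_rat_nat (q : rat) (a b : nat) : (0 <= q)%R ->
  (a%:R < q * b%:R)%R = (a * `|denq q| < `|numq q| * b)%N.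
Proof.
move=> q0; rewrite -{1}(divq_num_den q) mulrAC ltr_pdivlMr ?ltr0z ?denq_gt0 //.
have -> : numq q = `|numq q|%N by rewrite gez0_abs // numq_ge0.
have -> : denq q = `|denq q|%N by rewrite gez0_abs // denq_ge0.
by rewrite -!natrM ltr_nat absz_nat.
Qed.

Lemma comp_lt_rat (E : env) (f : E -> rat) (a b : E -> nat) :
  (forall x, 0 <= f x)%R -> computable f -> computable a -> computable b ->
  @computable E bool (fun x => (a x)%:R < f x * (b x)%:R)%R.
Proof.
move=> f0 cf ca cb.
have cd := comp_mul ca (comp_denq cf); have cn := comp_mul (comp_numq cf f0) cb.
by apply: eq_comp _ (comp_ltn cd cn) => x; rewrite lt_rat_nat.
Qed.

Lemma comp_nat_of_bool (E : env) (p : E -> bool) :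
  computable p -> @computable E nat (fun x => p x : nat).
Proof. by move/comp_bool. Qed.

(** The [t] lowest binary digits of [j], lowest first: as [j] runs below [2 ^ t], every string of
    length [t] occurs once. *)
Definition bits (t j : nat) : seq bool := mkseq (fun i => odd (j %/ 2 ^ i)) t.

Lemma comp_bits (E : env) (t j : E -> nat) :
  computable t -> computable j -> @computable E (seq bool) (fun x => bits (t x) (j x)).
Proof.
move=> ct cj; apply: (@comp_mkseq _ _ (fun x i => odd (j x %/ 2 ^ i))) => //.
apply: comp_odd; apply: comp_div; first comp_var.
by apply: comp_exp; [exact: comp_const | comp_var].
Qed.

Ltac comp_step := first [ comp_var | exact: comp_const | apply: comp_succ
  | apply: comp_add | apply: comp_mul | apply: comp_sub | apply: comp_exp
  | apply: comp_size | apply: comp_take | apply: comp_cat | apply: comp_bits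
  | apply: comp_nat_of_bool ].

Lemma computable_wn_ratP (g : seq bool -> nat -> rat) :
  computable_wn_rat g <-> computable2 g.
Proof.
split => -[c cP]; exists c; first by case=> -[[] t] w; exact: cP.
by move=> w t; exact: (cP ((tt, t), w)).
Qed.

(** * Computability of the rational approximations used in both directions *)

Section Approximations.
Let envW := env_cons (env_cons env_nil nat) (seq bool).
Let envWn := env_cons envW nat.
Let envWnn := env_cons envWn nat.
Variable g : seq bool -> nat -> rat.
Hypothesis g_comp : computable_wn_rat g.
Hypothesis g_ge0 : forall w t, (0 <= g w t)%R.

(* [2 ^+ n.+1 < g (take i w) t * (2 / r) ^+ i / 2 ^+ K] for [r = p / q], with
   denominators cleared. *)
Definition exceeds (K p q : nat) (w : seq bool) (t n : nat) : bool :=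
  [exists i : 'I_(size w).+1,
    ((2 ^ (K + n.+1) * p ^ i)%N%:R < g (take i w) t * ((2 * q) ^ i)%N%:R)%R].

(** Approximates the averages of the learner built from a gale: it counts the levels already
    certified by stage [t] of [g]. *)
Lemma computable_exceeds (K p q : nat) : computable_wn_rat (fun w t =>
  (\sum_(n < size w) exceeds K p q w t n)%:R / (size w)%:R)%R.
Proof.
have gP := (computable_wn_ratP g).1 g_comp; apply/computable_wn_ratP.
apply: comp_rat; last by repeat comp_step.
apply: (@comp_sum envW _ (fun z n => exceeds K p q z.2 z.1.2 n : nat)); first by repeat comp_step.
apply: comp_nat_of_bool.
apply: (@comp_exists envWn (fun z => (size z.1.2).+1) (fun z i =>
  ((2 ^ (K + z.2.+1) * p ^ i)%N%:R < g (take i z.1.2) z.1.1.2 * ((2 * q) ^ i)%N%:R)%R)).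
  by repeat comp_step.
apply: comp_lt_rat => //; try by repeat comp_step.
by apply: (comp_app2 gP); repeat comp_step.
Qed.

(* If [g] approximates [AVG l] from below, [i * g (take i x) t] may never attain the
   number of "yes" answers it converges to; but this number is at least [k.+1] as soon
   as the approximation is larger than [k]. *)
Definition reaches (x : seq bool) (t k : nat) : bool :=
  [exists i : 'I_(size x).+1, (k%:R < g (take i x) t * i%:R)%R].

(* [b ^ t * (1 + \sum_(k < t | reaches x t k) (a / b) ^+ k.+1)] *)
Definition payoff_num (a b : nat) (x : seq bool) (t : nat) : nat :=
  b ^ t + \sum_(k < t) reaches x t k * (a ^ k.+1 * b ^ (t - k.+1)).

(** Approximates the gale built from a learner: the mean payoff over all extensions by [t] bits,
    times [(p / (2 * q)) ^+ size w], written as a single fraction. *)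
Lemma computable_payoff (a b p q : nat) : computable_wn_rat (fun w t =>
  (p ^ size w * \sum_(j < 2 ^ t) payoff_num a b (w ++ bits t j) t)%:R /
  (2 ^ t * (b ^ t * (2 * q) ^ size w))%:R)%R.
Proof.
have gP := (computable_wn_ratP g).1 g_comp; apply/computable_wn_ratP.
apply: comp_rat; last by repeat comp_step.
apply: comp_mul; first by repeat comp_step.
apply: (@comp_sum envW _ (fun z j => payoff_num a b (z.2 ++ bits z.1.2 j) z.1.2)).
  by repeat comp_step.
apply: comp_add; first by repeat comp_step.
apply: (@comp_sum envWn _ (fun z k => reaches (z.1.2 ++ bits z.1.1.2 z.2) z.1.1.2 k
  * (a ^ k.+1 * b ^ (z.1.1.2 - k.+1)))); first by repeat comp_step.
apply: comp_mul; last by repeat comp_step.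
apply: comp_nat_of_bool.
apply: (@comp_exists envWnn (fun z => (size (z.1.1.2 ++ bits z.1.1.1.2 z.1.2)).+1) (fun z i =>
  (z.2%:R < g (take i (z.1.1.2 ++ bits z.1.1.1.2 z.1.2)) z.1.1.1.2 * i%:R)%R)).
  by repeat comp_step.
apply: comp_lt_rat => //; try by repeat comp_step.
by apply: (comp_app2 gP); repeat comp_step.
Qed.

End Approximations.

(** * Limits inferior, averages and martingales *)

Local Open Scope classical_set_scope.
Local Open Scope ring_scope.

Section LimInf.
Context {R : realType}.

Lemma le_limn_einf (u : nat -> \bar R) (a : \bar R) N :
  (forall n, (N <= n)%N -> (a <= u n)%E) -> (a <= limn_einf u)%E.
Proof.
move=> au; rewrite limn_einf_lim (cvg_lim (@ereal_hausdorff R) (@cvg_einfs_sup R u)).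
apply: le_trans (ereal_sup_ubound (imageT _ N)).
by apply/ereal_infP => _ [n Nn <-]; exact: au.
Qed.

Lemma lt_limn_einf (u : nat -> \bar R) (a : \bar R) :
  (a < limn_einf u)%E -> exists N, forall n, (N <= n)%N -> (a < u n)%E.
Proof.
rewrite limn_einf_lim (cvg_lim (@ereal_hausdorff R) (@cvg_einfs_sup R u)).
move=> /ereal_sup_gt [_ [N _ <-]] aN; exists N => n Nn.
by apply: lt_le_trans aN _; apply: ereal_inf_lbound; exists n.
Qed.

(** Besides the two inequalities, the approximations make [A] and [B] empty together, which matters
    because the infimum of the empty set is a mere default value. *)
Lemma inf_eq_of_approx (A B : set R) :
  (forall s, A s -> 0 <= s) -> (forall s, B s -> 0 <= s) ->
  (forall s e, A s -> 0 < e -> exists2 s', B s' & s' <= s + e) ->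
  (forall s e, B s -> 0 < e -> exists2 s', A s' & s' <= s + e) ->
  inf A = inf B.
Proof.
move=> A0 B0 AB BA.
have half (C D : set R) : (forall s, C s -> 0 <= s) ->
    (forall s e, D s -> 0 < e -> exists2 s', C s' & s' <= s + e) ->
    D !=set0 -> inf C <= inf D.
  move=> C0 DC D0; apply: lb_le_inf => // s Ds.
  apply/ler_addgt0Pr => e e0; have [s' Cs' s's] := DC _ _ Ds e0.
  by apply: le_trans s's; apply: ge_inf Cs'; exists 0 => x /C0.
have [[a Aa]|An] := pselect (A !=set0).
  have [b Bb _] := AB _ _ Aa ltr01.
  by apply/le_anti/andP; split; apply: half => //; [exists b | exists a].
have [[b Bb]|Bn] := pselect (B !=set0).
  by have [a Aa _] := BA _ _ Bb ltr01; case: An; exists a.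
congr inf; apply/seteqP; split => x Cx; [case: An | case: Bn]; by exists x.
Qed.

Lemma half_pow_lt (e : R) : 0 < e -> exists j, 2 ^- j < e.
Proof.
move=> e0; have := @cvg_geometric R 1 (2^-1).
have -> : `|2^-1 : R| < 1 by rewrite ger0_norm ?invr_ge0 // invf_lt1 // ltr1n.
move=> /(_ isT) /cvgrPdist_lt /(_ e e0) [j _ /(_ j (leqnn j))] /=.
rewrite sub0r normrN mul1r exprVn => H; exists j.
by apply: le_lt_trans H; exact: ler_norm.
Qed.

End LimInf.

Section Averages.
Context {R : realType}.
Implicit Types (f h : seq bool -> R) (w u v : seq bool) (L : nat).

(** The mean of [f] over the extensions of [w] by [L] bits, that is, a conditional expectation given
    [w]. *)
Fixpoint avg L f w : R :=
  if L is L'.+1 then (avg L' f (rcons w false) + avg L' f (rcons w true)) / 2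
  else f w.

Definition supermartingale f :=
  forall w, (f (rcons w false) + f (rcons w true)) / 2 <= f w.
Definition martingale f :=
  forall w, (f (rcons w false) + f (rcons w true)) / 2 = f w.

Lemma le_avg L f h w :
  (forall u, size u = L -> f (w ++ u) <= h (w ++ u)) -> avg L f w <= avg L h w.
Proof.
elim: L w => [|L IH] w fh /=; first by have := fh [::] erefl; rewrite cats0.
rewrite ler_pM2r ?invr_gt0 //.
by apply: lerD; apply: IH => u uL; rewrite cat_rcons; apply: fh; rewrite /= uL.
Qed.

Lemma eq_avg L f h w :
  (forall u, size u = L -> f (w ++ u) = h (w ++ u)) -> avg L f w = avg L h w.
Proof.
by move=> fh; apply/le_anti/andP; split; apply: le_avg => u uL; rewrite fh.
Qed.

Lemma avg_cst L (c : R) w : avg L (fun=> c) w = c.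
Proof. by elim: L w => //= L IH w; rewrite !IH; field. Qed.

Lemma avgD L f h w : avg L (fun u => f u + h u) w = avg L f w + avg L h w.
Proof. by elim: L w => //= L IH w; rewrite !IH; field. Qed.

Lemma avgZ L (c : R) f w : avg L (fun u => c * f u) w = c * avg L f w.
Proof. by elim: L w => //= L IH w; rewrite !IH; field. Qed.

Lemma avg_sum L (I : Type) (r : seq I) (F : I -> seq bool -> R) w :
  avg L (fun u => \sum_(i <- r) F i u) w = \sum_(i <- r) avg L (F i) w.
Proof.
elim: r => [|i r IH].
  by rewrite big_nil (eq_avg (h := fun=> 0)) ?avg_cst // => u _; rewrite big_nil.
rewrite big_cons -IH -avgD; apply: eq_avg => u _; exact: big_cons.
Qed.

(** The definition splits at the first appended bit; this splits at the last one. *)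
Lemma avgS L f w : avg L.+1 f w = avg L (fun u => (f (rcons u false) + f (rcons u true)) / 2) w.
Proof. by elim: L w => //= L IH w; rewrite -!IH. Qed.

Lemma avg_supermartingale L f w : supermartingale f -> avg L f w <= f w.
Proof.
move=> sf; elim: L w => //= L IH w; apply: le_trans (sf w).
by rewrite ler_pM2r ?invr_gt0 // lerD.
Qed.

Lemma avg_martingale L f w : martingale f -> avg L f w = f w.
Proof. by move=> mf; elim: L w => //= L IH w; rewrite !IH mf. Qed.

Lemma bitsS L j : bits L.+1 j = odd j :: bits L (j %/ 2).
Proof.
rewrite /bits /mkseq /= expn0 divn1; congr cons.
rewrite (iotaDl 1 0) -map_comp; apply: eq_map => i /=.
by rewrite -divnMA expnS.
Qed.

Lemma sum_double (F : nat -> R) n :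
  \sum_(j < n.*2) F j = \sum_(j < n) (F j.*2 + F j.*2.+1).
Proof.
elim: n => [|n IH]; first by rewrite !big_ord0.
by rewrite doubleS !big_ord_recr /= IH addrA.
Qed.

(** The first appended bit is the parity of [j], so the two halves of the recursion are the sums
    over even and over odd [j]. *)
Lemma avg_bits L f w : avg L f w = (\sum_(j < 2 ^ L) f (w ++ bits L j)) / 2 ^+ L.
Proof.
elim: L w => [|L IH] w /=.
  by rewrite big_ord1 /= cats0 expr0 divr1.
rewrite !IH -mulrDl -mulrA -invfM -exprSr; congr (_ / _).
rewrite expnS mul2n (sum_double (fun j => f (w ++ bits L.+1 j))) big_split /=.
congr (_ + _); apply: eq_bigr => j _; rewrite cat_rcons bitsS.
  by rewrite odd_double divn2 doubleK.
by rewrite divn2 (half_bit_double j true) /= odd_double.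
Qed.


End Averages.

(** * Outer measure of unions of cylinders *)

Section Lambda.
Context {R : realType}.
Implicit Types (w u v : seq bool) (L : nat).

(* The measure of the cylinder of [v] conditioned to the cylinder of [w]. *)
Definition cyl_weight v w : R :=
  avg (size v - size w) (fun u => (seq.prefix v u)%:R) w.

Lemma prefix_rcons_le v w b :
  (size v <= size w)%N -> seq.prefix v (rcons w b) = seq.prefix v w.
Proof.
move=> vw; rewrite !prefixE -cats1 take_cat.
case: ltngtP vw => // e _; rewrite e subnn take0 cats0 take_oversize ?e //.
Qed.

Lemma cyl_weight_ge0 v w : 0 <= cyl_weight v w.
Proof.
by rewrite -(avg_cst (size v - size w) 0 w); apply: le_avg => u _.
Qed.

Lemma cyl_weight_prefix v w : (size v <= size w)%N ->
  cyl_weight v w = (seq.prefix v w)%:R.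
Proof. by rewrite /cyl_weight -subn_eq0 => /eqP ->. Qed.

Lemma martingale_cyl_weight v : martingale (cyl_weight v).
Proof.
move=> w; have [vw|wv] := leqP (size v) (size w).
  rewrite !cyl_weight_prefix ?size_rcons ?leqW // !prefix_rcons_le //.
  by field.
by rewrite /cyl_weight -(subnSK wv) /= !size_rcons.
Qed.

(** At each bit of [v] only the child agreeing with it contributes, which halves the weight. The
    induction needs an arbitrary starting string [w]. *)
Lemma cyl_weight_nil v : cyl_weight v [::] = 2 ^- size v.
Proof.
rewrite /cyl_weight subn0.
suff H w : avg (size v) (fun u => (seq.prefix (w ++ v) u)%:R) w = 2 ^- size v :> R.
  exact: (H [::]).
elim: v w => [|b v IH] w; first by rewrite /= cats0 prefix_refl expr0 invr1.
have H0 : avg (size v) (fun u => (seq.prefix (w ++ b :: v) u)%:R) (rcons w (~~ b)) = 0 :> R.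
  rewrite -(avg_cst (size v) 0 (rcons w (~~ b))); apply: eq_avg => u _.
  by rewrite cat_rcons prefix_catr // eqxx prefix_cons; case: (b).
have H1 : avg (size v) (fun u => (seq.prefix (w ++ b :: v) u)%:R) (rcons w b) = 2 ^- size v :> R.
  by rewrite -(IH (rcons w b)) cat_rcons.
by case: b H0 H1 => /= -> ->; rewrite exprS invfM ?addr0 ?add0r mulrC.
Qed.

(** The strings of [B], enumerated through [pickle_inv], cover [A]; every partial sum of their
    weights runs over a finite duplicate-free family, to which the bound [c] applies. *)
Lemma lambda_le (A : set (nat -> bool)) (B : pred (seq bool)) (c : R) :
  (forall F, uniq F -> all B F -> \sum_(v <- F) 2 ^- size v <= c) ->
  (forall Y, A Y -> exists2 v, B v & cyl v Y) ->
  (lambda (R:=R) A <= c%:E)%E.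
Proof.
move=> Bc AB; apply/lee_addgt0Pr => e e0.
have [j je] := half_pow_lt e0.
(* A cover is indexed by all of [nat]: the unused indices are filled with cylinders of
   total measure less than [e]. *)
pose ws k := if pickle_inv k is Some v then
  if B v then v else nseq (j + k.+1) false else nseq (j + k.+1) false.
pose a k : R := if pickle_inv k is Some v then
  if B v then 2 ^- size v else 0 else 0.
have a0 k : 0 <= a k.
  by rewrite /a; case: pickle_inv => // v; case: (B v).
have cov : A `<=` \bigcup_k cyl (ws k).
  move=> Y /AB [v Bv vY]; exists (pickle v) => //.
  by rewrite /ws pickleK_inv Bv.
apply: (@le_trans _ _ (\sum_(0 <= k <oo) (2 ^- size (ws k))%:E)%E).
  by apply: ereal_inf_lbound; exists ws.
apply: (@le_trans _ _ (\sum_(0 <= k <oo) ((a k)%:E + (e / (2 ^ k.+1)%:R)%:E))%E).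
  apply: lee_nneseries => k _; first by rewrite lee_fin invr_ge0 exprn_ge0.
  have fil : 2 ^- (j + k.+1) <= e / (2 ^ k.+1)%:R :> R.
    by rewrite exprD invfM natrX ler_wpM2r ?invr_ge0 ?exprn_ge0 // ltW.
  have e20 : 0 <= e / (2 ^ k.+1)%:R by rewrite divr_ge0 // ltW.
  rewrite -EFinD lee_fin /a /ws; case: pickle_inv => [v|]; last first.
    by rewrite size_nseq add0r.
  by case: (B v); rewrite ?size_nseq ?add0r // lerDl.
apply: le_trans (epsilon_trick _ _ _) _ => //; first by rewrite ltW.
rewrite leeD2r //; apply: lime_le; first by apply: is_cvg_nneseries => n _ _; rewrite lee_fin.
near=> n; rewrite sumEFin lee_fin.
have := Bc [seq v <- pmap (@pickle_inv (seq bool)) (iota 0 n) | B v].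
rewrite filter_all => /(_ _ isT).
have un : uniq (pmap (@pickle_inv (seq bool)) (iota 0 n)).
  by apply: (pmap_uniq (@pickle_invK _)); exact: iota_uniq.
rewrite filter_uniq // => /(_ isT); apply: le_trans.
rewrite /index_iota subn0 big_filter; elim: (iota 0 n) => [|k s IH].
  by rewrite !big_nil.
rewrite big_cons /= /a; case: pickle_inv => [v|] /=; last by rewrite add0r.
rewrite big_cons; case: (B v); first by rewrite lerD2l.
by rewrite add0r.
Unshelve. all: by end_near. Qed.

End Lambda.

Section LambdaLower.
Context {R : realType}.
Implicit Types (w u v : seq bool) (L : nat).

Lemma martingale_super (f : seq bool -> R) : martingale f -> supermartingale f.
Proof. by move=> mf w; rewrite mf. Qed.

(* Always move to the child with the smaller capital. *)
Lemma supermartingale_path (f : seq bool -> R) (c : R) u :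
  supermartingale f -> f u < c ->
  exists2 Y, cyl u Y & forall n, (size u <= n)%N -> f (prefix Y n) < c.
Proof.
move=> mf fu; pose step x := rcons x (c <= f (rcons x false)).
have stepP x : f x < c -> f (step x) < c.
  rewrite /step; case: (ltP (f (rcons x false)) c) => // h /(le_lt_trans (mf x)).
  by move: h; set a := f _; set b := f _; lra.
pose ext n := iter n step u.
have extP n : f (ext n) < c by elim: n => //= n; exact: stepP.
have size_ext n : size (ext n) = (n + size u)%N.
  by elim: n => //= n IH; rewrite size_rcons -/(ext n) IH.
pose Y i := nth false (ext i.+1) i.
have nth_ext i n m : (n <= m)%N -> (i < size (ext n))%N ->
    nth false (ext m) i = nth false (ext n) i.
  move=> /subnK <-; elim: (m - n)%N => // k IH ilt.
  rewrite addSn [ext _]/= nth_rcons -/(ext (k + n)) IH //.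
  by rewrite (leq_trans ilt) // !size_ext leq_add2r leq_addl.
have YP n : prefix Y (n + size u) = ext n.
  apply: (@eq_from_nth _ false); rewrite size_mkseq ?size_ext // => i iL.
  rewrite nth_mkseq // /Y; have [ni|ni] := leqP n i.+1.
    by rewrite (nth_ext i n i.+1) // size_ext.
  by rewrite (nth_ext i i.+1 n (ltnW ni)) // size_ext ltn_addr.
exists Y; first by have := YP 0%N; rewrite add0n.
by move=> n /subnK <-; rewrite YP.
Qed.

Lemma size_prefix_seq (X : nat -> bool) n : size (prefix X n) = n.
Proof. exact: size_mkseq. Qed.

Lemma take_prefix_seq (X : nat -> bool) m n : (m <= n)%N ->
  take m (prefix X n) = prefix X m.
Proof. by move=> mn; rewrite /prefix /mkseq -map_take take_iota (minn_idPl mn). Qed.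

(** The total conditional weight [W] of a cover is a martingale, finite everywhere once it is finite
    at the root. It is at least 1 at each [u] satisfying [S], so averaging at length [L] bounds its
    initial value. The path argument below takes the place of compactness. *)
Lemma lambda_ge (A : set (nat -> bool)) L (S : pred (seq bool)) :
  (forall u, size u = L -> S u -> cyl u `<=` A) ->
  ((avg L (fun u => (S u)%:R) [::] : R)%:E <= lambda (R:=R) A)%E.
Proof.
move=> SA; apply/ereal_infP => _ [ws [Aws ->]].
pose W v : \bar R := (\sum_(0 <= k <oo) (cyl_weight (ws k) v)%:E)%E.
have cw0 v k : (0 <= (cyl_weight (ws k) v : R)%:E)%E by rewrite lee_fin cyl_weight_ge0.
have W0 v : (0 <= W v)%E by apply: nneseries_ge0.
have -> : (\sum_(0 <= k <oo) (2 ^- size (ws k))%:E = W [::])%E.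
  by apply: eq_eseriesr => k _; rewrite cyl_weight_nil.
have [Woo|] := eqVneq (W [::]) +oo%E; first by rewrite Woo leey.
rewrite -ltey => Wfin.
have WD v : (W (rcons v false) + W (rcons v true) = W v + W v)%E.
  rewrite /W -!nneseriesD //; apply: eq_eseriesr => k _; rewrite -!EFinD.
  by congr (_%:E); rewrite -(martingale_cyl_weight (ws k) v); field.
have Wlt v : (W v < +oo)%E.
  elim/last_ind: v => // v b IH.
  have : (W v + W v < +oo)%E by rewrite lte_add_pinfty.
  apply: le_lt_trans; rewrite -WD; case: b; first by rewrite leeDr.
  by rewrite leeDl.
have WE v : ((fine (W v))%:E = W v)%E by rewrite fineK // ge0_fin_numE.
pose f v := fine (W v).
have mf : martingale f.
  move=> v; apply: EFin_inj.
  have : ((f (rcons v false) + f (rcons v true))%:E = (f v + f v)%:E)%E.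
    by rewrite !EFinD !WE WD.
  by move=> [->]; congr (_%:E); field.
rewrite -WE lee_fin -/(f [::]) -(avg_martingale L [::] mf); apply: le_avg => u uL /=.
case Su: (S u); last by rewrite fine_ge0.
(* If [W u < 1], some [Y] through [u] keeps [W] below 1 forever; but [Y] lies in a covering
   cylinder, which contributes 1 on all long enough prefixes of [Y]. *)
rewrite leNgt; apply/negP => fu.
have [Y uY Yf] := supermartingale_path (martingale_super mf) fu.
have [k _ kY] := Aws _ (SA _ uL Su _ uY).
have := Yf _ (leq_maxl (size u) (size (ws k))); apply/negP; rewrite -leNgt -lee_fin WE.
set n := maxn _ _; have kn : (size (ws k) <= n)%N by exact: leq_maxr.
apply: (@le_trans _ _ (\sum_(0 <= i < k.+1) (cyl_weight (ws i) (prefix Y n))%:E)%E); last first.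
  rewrite /W; apply: nneseries_lim_ge => i _ _; exact: cw0.
rewrite big_nat_recr //= cyl_weight_prefix ?size_prefix_seq //.
rewrite prefixE take_prefix_seq // (kY : prefix Y _ = _) eqxx leeDr //.
by apply: sume_ge0.
Qed.
End LambdaLower.

(** * The maximal inequality, for averages and for the outer measure *)

Section Maximal.
Context {R : realType}.
Variables (m : seq bool -> R) (c : R).
Hypotheses (m_super : supermartingale m) (m_ge0 : forall w, 0 <= m w) (c_gt0 : 0 < c).
Implicit Types (w u v : seq bool) (L : nat).

Definition hit u : bool := [exists i : 'I_(size u).+1, c < m (take i u)].

Lemma hitP u : reflect (exists2 i, (i <= size u)%N & c < m (take i u)) (hit u).
Proof.
apply: (iffP existsP) => [[i ci]|[i iu ci]]; first by exists i; rewrite // -ltnS.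
by exists (Ordinal (iu : (i < (size u).+1)%N)).
Qed.

Lemma hit_rcons w b : hit (rcons w b) = hit w || (c < m (rcons w b)).
Proof.
apply/hitP/orP => [[i]|[/hitP[i iw ci]|ci]].
- rewrite size_rcons leq_eqVlt => /orP[/eqP->|].
    by rewrite take_oversize ?size_rcons //; right.
  rewrite ltnS => iw; rewrite -cats1 takel_cat // => ci; left; apply/hitP.
  by exists i.
- by exists i; rewrite ?size_rcons ?leqW // -cats1 takel_cat.
- by exists (size w).+1; rewrite ?size_rcons // take_oversize // size_rcons.
Qed.

(* Doob's maximal inequality, by stopping [m] at level [c]. *)
Lemma avg_hit L : avg L (fun u => (hit u)%:R) [::] * c <= m [::].
Proof.
pose F w := if hit w then c else m w.
have Fc w : F w <= m w -> (hit w)%:R * c <= F w.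
  by rewrite /F; case: (hit w); rewrite ?mul1r ?mul0r.
have hF w : (hit w)%:R * c <= F w by rewrite /F; case: (hit w); rewrite ?mul1r ?mul0r.
have Fsup : supermartingale F.
  move=> w; rewrite /F !hit_rcons; case hw: (hit w) => /=; first by lra.
  apply: le_trans (m_super w); rewrite ler_pM2r ?invr_gt0 //.
  by apply: lerD; case: ltP => // /ltW.
have F0 : F [::] <= m [::].
  by rewrite /F; case: ifP => // /hitP[[|i] _ /ltW].
apply: le_trans F0; apply: le_trans (avg_supermartingale L [::] Fsup).
by rewrite mulrC -avgZ; apply: le_avg => u _; rewrite mulrC.
Qed.

(** [B] consists of the strings where [m] exceeds [c] for the first time. They are pairwise
    incomparable, so at most one of them is a prefix of a given [u], and then [u] has hit [c]. *)
Lemma lambda_hit :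
  (lambda (R:=R) [set Y | exists n, (c < m (prefix Y n))%R] <= (m [::] / c)%:E)%E.
Proof.
pose B v := (c < m v) && ~~ [exists i : 'I_(size v), c < m (take i v)].
have Bhit v u : B v -> seq.prefix v u -> hit u.
  move=> /andP[cv _] /prefixP[x ->]; apply/hitP; exists (size v).
    by rewrite size_cat leq_addr.
  by rewrite take_size_cat.
have Buniq v v' u : B v -> B v' -> seq.prefix v u -> seq.prefix v' u -> v = v'.
  wlog vv' : v v' / (size v <= size v')%N => [H|].
    by case/orP: (leq_total (size v) (size v')) => s Bv Bv' p p';
      [|symmetry]; apply: H.
  move=> /andP[cv _] /andP[_ nv']; rewrite !prefixE => /eqP ev /eqP ev'.
  have tv : v = take (size v) v' by rewrite -ev' take_takel // ev.
  move: vv'; rewrite leq_eqVlt => /orP[/eqP e|lt]; first by rewrite tv e take_size.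
  by case/negP: nv'; apply/existsP; exists (Ordinal lt); rewrite /= -tv.
apply: (@lambda_le _ _ B) => [F Fu FB|Y [n cn]]; last first.
  have ex : exists n, c < m (prefix Y n) by exists n.
  case: (ex_minnP ex) => k ck kmin; exists (prefix Y k); last by rewrite /cyl /= size_prefix_seq.
  rewrite /B ck /=; apply/existsP => -[[i /=]]; rewrite size_prefix_seq => ik.
  by rewrite take_prefix_seq 1?ltnW // => /kmin; rewrite leqNgt ik.
(* At a length [L] not shorter than any member of [F], the conditional weights are indicators and
   can be compared with [hit] pointwise. *)
rewrite ler_pdivlMr //; pose L := (\max_(v <- F) size v)%N.
apply: le_trans (avg_hit L); rewrite ler_pM2r //.
under eq_bigr => v _ do
  rewrite -cyl_weight_nil -(avg_martingale L [::] (martingale_cyl_weight v)).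
rewrite -avg_sum; apply: le_avg => u uL /=.
have -> : \sum_(v <- F) cyl_weight v u = (count (fun v => seq.prefix v u) F)%:R :> R.
  rewrite -sum1_count natr_sum [RHS]big_mkcond /=; apply: eq_big_seq => v vF.
  rewrite cyl_weight_prefix; first by case: seq.prefix.
  by rewrite uL /L; exact: (leq_bigmax_seq _ vF).
rewrite ler_nat -size_filter.
case E: [seq v <- F | seq.prefix v u] => [|v s] //.
have Fv x : x \in v :: s -> B x /\ seq.prefix x u.
  by rewrite -E mem_filter => /andP[px xF]; split=> //; exact: (allP FB).
have [Bv pv] := Fv v (mem_head _ _); rewrite (Bhit _ _ Bv pv).
have := filter_uniq (fun v => seq.prefix v u) Fu; rewrite E; case: s E Fv => // v' s _ Fv /=.
have [Bv' pv'] : B v' /\ seq.prefix v' u by apply: Fv; rewrite !inE eqxx orbT.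
by rewrite (Buniq _ _ _ Bv Bv' pv pv') inE eqxx.
Qed.

End Maximal.

(** * From learners to gales *)

Definition yes_count (l : seq bool -> bool) (w : seq bool) : nat :=
  \sum_(i < (size w).+1) l (take i w).

Lemma AVGE (R : realType) (l : seq bool -> bool) (w : seq bool) :
  AVG (R:=R) l w = (yes_count l w)%:R / (size w)%:R.
Proof. by rewrite /AVG natr_sum. Qed.

Lemma yes_count_prefix (l : seq bool -> bool) (Y : nat -> bool) i :
  yes_count l (prefix Y i) = size [seq j <- iota 0 i.+1 | l (prefix Y j)].
Proof.
rewrite size_filter -sum1_count big_mkcond /yes_count size_prefix_seq.
rewrite -(big_mkord xpredT (fun j => l (take j (prefix Y i)) : nat)) /index_iota subn0.
apply: eq_big_seq => j; rewrite mem_iota add0n => /andP[_ ji].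
by rewrite take_prefix_seq //; case: (l _).
Qed.

Lemma count_of_many_yes (l : seq bool -> bool) (Y : nat -> bool) n :
  many_yes l n Y -> exists i, (n <= yes_count l (prefix Y i))%N.
Proof.
move=> [s [us <- /allP ls]]; exists (\max_(j <- s) j)%N.
rewrite yes_count_prefix uniq_leq_size // => j js.
by rewrite mem_filter ls // mem_iota add0n ltnS; exact: (leq_bigmax_seq _ js).
Qed.

Section FromLearner.
Context {R : realType}.
Variables (l : seq bool -> bool) (g : seq bool -> nat -> rat).
Hypothesis g_nd : forall w t, g w t <= g w t.+1.
Hypothesis g_le : forall w t, ratr (g w t) <= AVG (R:=R) l w.
Hypothesis g_cvg : forall w, (fun t => ratr (g w t) : R) @ \oo --> AVG (R:=R) l w.
Hypothesis l_small : forall n, (lambda (R:=R) (many_yes l n) <= ((2:R) ^- n)%:E)%E.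
Variables a b : nat.
Hypotheses (b_gt0 : (0 < b)%N) (le_ba : (b <= a)%N) (lt_a2b : (a < 2 * b)%N).

Let rho : R := a%:R / b%:R.

Lemma rho_ge1 : 1 <= rho.
Proof. by rewrite /rho ler_pdivlMr ?ltr0n // mul1r ler_nat. Qed.

Lemma rho_lt2 : rho < 2.
Proof. by rewrite /rho ltr_pdivrMr ?ltr0n // -natrM ltr_nat. Qed.

Lemma many_yes_of_count (Y : nat -> bool) i n :
  (n <= yes_count l (prefix Y i))%N -> many_yes l n Y.
Proof.
rewrite yes_count_prefix; set s := [seq _ <- _ | _] => nY; exists (take n s); split.
- by rewrite take_uniq // filter_uniq // iota_uniq.
- by rewrite size_takel.
- by apply/allP => j /mem_take; rewrite mem_filter => /andP[].
Qed.

Lemma g_nd_le w : {homo g w : s t / (s <= t)%N >-> s <= t}.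
Proof. by apply: homo_leq => //; exact: le_trans. Qed.

Lemma reaches_le x y s t k : (s <= t)%N -> reaches g x s k -> reaches g (x ++ y) t k.
Proof.
move=> st /existsP[[i ix] /= ki]; apply/existsP.
have ixy : (i < (size (x ++ y)).+1)%N by rewrite size_cat (leq_trans ix) // ltnS leq_addr.
exists (Ordinal ixy); rewrite /= takel_cat //; apply: lt_le_trans ki _.
by rewrite ler_wpM2r // g_nd_le.
Qed.

Lemma reaches_yes_count x t k : reaches g x t k ->
  exists2 i, (i <= size x)%N & (k < yes_count l (take i x))%N.
Proof.
move=> /existsP[[i ix] /= ki]; exists i => //; rewrite -(ltr_nat R).
have i0 : (0 < i)%N.
  by rewrite lt0n; apply: contraTneq ki => ->; rewrite mulr0 -leNgt ler0n.
have := g_le (take i x) t; rewrite AVGE size_takel // ler_pdivlMr ?ltr0n //.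
apply: lt_le_trans.
by move: ki; rewrite -(ltr_rat R) rmorphM /= !ratr_nat.
Qed.

Definition payoff x t : R := (payoff_num g a b x t)%:R / b%:R ^+ t.

Lemma payoffE x t :
  payoff x t = 1 + \sum_(k < t) (reaches g x t k)%:R * rho ^+ k.+1.
Proof.
have bn : (b%:R : R) != 0 by rewrite pnatr_eq0 -lt0n.
rewrite /payoff /payoff_num natrD mulrDl natrX divff ?expf_neq0 //.
congr (1 + _); rewrite natr_sum mulr_suml; apply: eq_bigr => k _.
rewrite !natrM -mulrA !natrX; congr (_ * _); rewrite /rho expr_div_n -mulrA.
congr (_ * _); rewrite -[in X in _ / X](subnK (ltn_ord k)) exprD invfM mulrA.
by rewrite divff ?expf_neq0 // mul1r.
Qed.

Lemma payoff_ge1 x t : 1 <= payoff x t.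
Proof.
rewrite payoffE lerDl sumr_ge0 // => k _.
by rewrite mulr_ge0 // exprn_ge0 // (le_trans ler01 rho_ge1).
Qed.

Lemma payoff_le x y s t : (s <= t)%N -> payoff x s <= payoff (x ++ y) t.
Proof.
move=> st; rewrite !payoffE lerD2l.
have h0 k : 0 <= (reaches g (x ++ y) t k)%:R * rho ^+ k.+1.
  by rewrite mulr_ge0 // exprn_ge0 // (le_trans ler01 rho_ge1).
rewrite -!(big_mkord xpredT (fun k => (reaches g _ _ k)%:R * rho ^+ k.+1)).
rewrite [leRHS](big_cat_nat (n := s)) //= -[leLHS]addr0.
apply: lerD; last by apply: sumr_ge0.
apply: ler_sum => k _; rewrite ler_wpM2r ?exprn_ge0 ?(le_trans ler01 rho_ge1) //.
by rewrite ler_nat; case E: (reaches _ x _ _) => //; rewrite (reaches_le y st E).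
Qed.

(** The [t]-th approximation looks [t] bits ahead and runs [g] for [t] steps, so it is a finite
    computation. *)
Definition stage t w : R := avg t (payoff^~ t) w.

(** The mean over the two children looks [t.+1] bits ahead but runs [g] for [t] steps only, so it
    lies between stages [t] and [t.+1]. This sandwich gives monotonicity in [t] and, in the limit,
    the martingale equality. *)
Lemma stage_le_children t w :
  stage t w <= (stage t (rcons w false) + stage t (rcons w true)) / 2.
Proof.
rewrite -[leRHS]/(avg t.+1 (payoff^~ t) w) avgS; apply: le_avg => u _.
have h c : payoff (w ++ u) t <= payoff (rcons (w ++ u) c) t.
  by rewrite -cats1; exact: payoff_le.
by move: (h true) (h false); lra.
Qed.

Lemma children_le_stage t w :
  (stage t (rcons w false) + stage t (rcons w true)) / 2 <= stage t.+1 w.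
Proof.
rewrite -[leLHS]/(avg t.+1 (payoff^~ t) w); apply: le_avg => u _.
by rewrite -[X in payoff X t.+1]cats0; apply: (@payoff_le _ [::]).
Qed.

Lemma stage_nd w : {homo stage^~ w : s t / (s <= t)%N >-> s <= t}.
Proof.
apply: homo_leq => //; first exact: le_trans.
by move=> t; exact: le_trans (stage_le_children t w) (children_le_stage t w).
Qed.

Lemma stage_ge0 t w : 0 <= stage t w.
Proof.
by rewrite -(avg_cst t 0 w); apply: le_avg => u _; exact: le_trans ler01 (payoff_ge1 _ _).
Qed.

(** By [lambda_ge], the proportion of strings reaching [k] is at most [2 ^- k.+1], so the expected
    payoff is dominated by a geometric series of ratio [rho / 2]. *)
Lemma stage_nil_le t : stage t [::] <= (1 - rho / 2)^-1.
Proof.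
have x1 : rho / 2 < 1 by rewrite ltr_pdivrMr // mul1r rho_lt2.
have x0 : 0 <= rho / 2 by rewrite divr_ge0 // (le_trans ler01 rho_ge1).
apply: (@le_trans _ _ (\sum_(k < t.+1) (rho / 2) ^+ k)); last first.
  rewrite -[leRHS]mul1r ler_pdivlMr ?subr_gt0 //.
  by rewrite mulrC -opprB mulNr -subrX1 opprB gerBl exprn_ge0.
rewrite /stage (@eq_avg _ _ _ (fun u => 1 + \sum_(k <- iota 0 t) rho ^+ k.+1 * (reaches g u t k)%:R)).
  rewrite avgD avg_cst avg_sum big_ord_recl expr0 lerD2l.
  rewrite -(big_mkord xpredT (fun k => (rho / 2) ^+ k.+1)) /index_iota subn0.
  apply: ler_sum => k _; rewrite avgZ [(rho / 2) ^+ _]exprMn ler_wpM2l ?exprn_ge0 ?(le_trans ler01 rho_ge1) //.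
  rewrite exprVn -lee_fin; apply: le_trans (l_small k.+1).
  apply: lambda_ge => u ut /reaches_yes_count[i iu ki] Y uY.
  by apply: (@many_yes_of_count Y i); rewrite -(take_prefix_seq Y iu) (uY : prefix Y _ = u).
move=> u _; rewrite payoffE -(big_mkord xpredT (fun k => (reaches g _ _ k)%:R * rho ^+ k.+1)).
by rewrite /index_iota subn0; congr (1 + _); apply: eq_bigr => k _; rewrite mulrC.
Qed.

(** The bound at the root spreads to all strings: stages are nonnegative, so a child's stage is at
    most twice the next stage of its parent. *)
Lemma stage_ub w : exists C, forall t, stage t w <= C.
Proof.
elim/last_ind: w => [|w c [C wC]]; first by exists (1 - rho / 2)^-1 => t; exact: stage_nil_le.
exists (2 * C) => t; have := le_trans (children_le_stage t w) (wC t.+1).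
by have := stage_ge0 t (rcons w true); have := stage_ge0 t (rcons w false);
  case: c; lra.
Qed.

Definition capital w : R := limn (stage^~ w).

Lemma cvg_stage w : stage^~ w @ \oo --> capital w.
Proof.
apply: nondecreasing_is_cvgn; first exact: stage_nd.
by have [C wC] := stage_ub w; exists C => _ [t _ <-].
Qed.

Lemma stage_le_capital t w : stage t w <= capital w.
Proof.
by apply: nondecreasing_cvgn_le; [exact: stage_nd | apply/cvg_ex; exists (capital w); exact: cvg_stage].
Qed.

Lemma capital_ge0 w : 0 <= capital w.
Proof. exact: le_trans (stage_ge0 0 w) (stage_le_capital 0 w). Qed.

Lemma martingale_capital : martingale capital.
Proof.
move=> w.
have h1 : (fun t => (stage t (rcons w false) + stage t (rcons w true)) / 2) @ \oo -->
    (capital (rcons w false) + capital (rcons w true)) / 2.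
  by apply: cvgMl; apply: cvgD; exact: cvg_stage.
have h2 : (fun t => stage t.+1 w) @ \oo --> capital w.
  by rewrite (cvg_shiftS (stage^~ w)); exact: cvg_stage.
apply: (@cvg_unique _ (@Rhausdorff R) _ _ _ _ h1); apply: squeeze_cvgr (@cvg_stage w) h2.
near=> t; by rewrite stage_le_children children_le_stage.
Unshelve. all: by end_near. Qed.

(** With [k.+1] yes answers, [AVG] strictly exceeds [k / size w], so a late enough [g] does too.
    Then every extension of [w] reaches [k], and the single summand [rho ^+ k.+1] suffices. *)
Lemma capital_ge w : (0 < size w)%N -> rho ^+ yes_count l w <= capital w.
Proof.
move=> w0; have [->|] := posnP (yes_count l w).
  rewrite expr0; apply: le_trans (stage_le_capital 0 w); exact: payoff_ge1.
case Nw : (yes_count l w) => [//|k] _.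
have kA : k%:R / (size w)%:R < AVG (R:=R) l w.
  by rewrite AVGE Nw ltr_pM2r ?invr_gt0 ?ltr0n // ltr_nat.
have /cvgrPdist_lt := @g_cvg w.
rewrite -subr_gt0 in kA; move=> /(_ _ kA) [t0 _ t0P].
(* The payoff at stage [t] sums over indices below [t] only, so [t] must also exceed [k]. *)
pose t := maxn t0 k.+1; have tk : (k < t)%N by rewrite leq_maxr.
apply: le_trans (stage_le_capital t w).
rewrite -(avg_cst t (rho ^+ k.+1) w); apply: le_avg => u _.
have : reaches g (w ++ u) t k.
  apply: (@reaches_le w u t t) => //; apply/existsP; exists ord_max; rewrite /= take_size.
  have := t0P t (leq_maxl _ _); rewrite /= ger0_norm ?subr_ge0 //.
  rewrite ltrD2l ltrN2 ltr_pdivrMr ?ltr0n // => H.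
  by rewrite -(ltr_rat R) rmorphM /= !ratr_nat.
move=> ru; rewrite payoffE (bigD1 (Ordinal tk)) //= ru mul1r addrCA lerDl addr_ge0 //.
apply: sumr_ge0 => i _; by rewrite mulr_ge0 // exprn_ge0 // (le_trans ler01 rho_ge1).
Qed.

End FromLearner.

(** * Real powers of two and exponents whose power of two is rational *)

Section PowersOfTwo.
Context {R : realType}.
Implicit Types x y : R.

Lemma pow2E x : 2 `^ x = expR (x * ln 2).
Proof. by rewrite /powR pnatr_eq0. Qed.

Lemma ln2_gt0 : 0 < ln 2 :> R.
Proof. by rewrite ln_gt0 // ltr1n. Qed.

Lemma ler_pow2 x y : (2 `^ x <= 2 `^ y) = (x <= y).
Proof. by rewrite !pow2E ler_expR ler_pM2r // ln2_gt0. Qed.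

Lemma ltr_pow2 x y : (2 `^ x < 2 `^ y) = (x < y).
Proof. by rewrite !pow2E ltr_expR ltr_pM2r // ln2_gt0. Qed.

Lemma pow2D x y : 2 `^ (x + y) = 2 `^ x * 2 `^ y.
Proof. by rewrite powRD // pnatr_eq0 implybT. Qed.

Lemma pow2M x n : 2 `^ (x * n%:R) = (2 `^ x) ^+ n.
Proof. by rewrite powRrM powR_mulrn // powR_ge0. Qed.

Lemma pow2_ge x : x * ln 2 <= 2 `^ x.
Proof. by rewrite pow2E; apply: le_trans (expR_ge1Dx _); rewrite lerDr. Qed.

(** Take the binary logarithm of a rational lying strictly between the two powers. *)
Lemma pow2_rat_dense x y : x < y ->
  exists p q : nat, exists2 z, x < z < y &
    [/\ (0 < p)%N, (0 < q)%N & 2 `^ z = p%:R / q%:R].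
Proof.
rewrite -ltr_pow2 => /rat_in_itvoo [r]; rewrite in_itv /= => /andP[xr ry].
have r0 : 0 < ratr r :> R by apply: le_lt_trans xr; exact: powR_ge0.
have qr0 : 0 < r by rewrite -(ltr_rat R) rmorph0.
have rE : ratr r = `|numq r|%N%:R / `|denq r|%N%:R :> R.
  by rewrite !natr_absz !ger0_norm ?denq_ge0 // numq_ge0 ltW.
have zE : 2 `^ (ln (ratr r) / ln 2) = ratr r :> R.
  by rewrite pow2E divfK ?lnK // gt_eqF // ln2_gt0.
exists `|numq r|%N, `|denq r|%N, (ln (ratr r) / ln 2).
  by rewrite -(ltr_pow2 x) -(ltr_pow2 _ y) zE xr ry.
by split; rewrite ?zE // absz_gt0 gt_eqF // numq_gt0.
Qed.

End PowersOfTwo.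

Lemma eq_gale (R : realType) (s : R) (d : seq bool -> R) w :
  (d w * powR 2 (- (s * (size w)%:R)) =
   d (rcons w false) * powR 2 (- (s * (size w).+1%:R)) +
   d (rcons w true) * powR 2 (- (s * (size w).+1%:R))) <->
  (2 `^ s * d w = d (rcons w false) + d (rcons w true)).
Proof.
have x0 : 2 `^ s != 0 by rewrite gt_eqF // powR_gt0.
rewrite !powRN !pow2M exprS -mulrDl; split.
  move=> /(congr1 (fun y => y * (2 `^ s * (2 `^ s) ^+ size w))).
  by rewrite divfK ?mulf_neq0 ?expf_neq0 // => <-; field; rewrite expf_neq0.
by move=> <-; field; rewrite x0 expf_neq0.
Qed.

Lemma gale_of_learner (R : realType) (s e : R) (l : seq bool -> bool) : 0 <= s -> 0 < e ->
  lower_semicomputable (AVG (R:=R) l) ->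
  (forall n, (lambda (R:=R) (many_yes l n) <= ((2:R) ^- n)%:E)%E) ->
  exists2 s', 0 <= s' <= s + e &
    exists d : seq bool -> R, [/\ lower_semicomputable d, is_gale s' d &
      forall X, strongly_learns s l X -> succeeds_strongly d X].
Proof.
move=> s0 e0 [g [g_comp g0 g_nd g_le g_cvg]] l_small.
have sse : s < s + e by rewrite ltrDl.
have [p [q [s' /andP[ss' s'e] [p0 q0 rE]]]] := pow2_rat_dense sse.
(* The gap is spent in four parts: one for the limit inferior, one for [th] being below 1, one for
   the extra answer in a count up to [n.+1], and the last remains as the growth rate of [d]. *)
pose k := (s' - s) / 4; have k0 : 0 < k by rewrite divr_gt0 // subr_gt0.
(* The maximum with 0 forces [th] to be positive, hence [rho] to be at least 1. *)
have k1 : Num.max 0 (1 - k) < 1 by rewrite gt_max ltr01 gtrBl.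
have [a [b [th /andP[thk th1] [a0 b0 rhoE]]]] := pow2_rat_dense k1.
move: thk; rewrite gt_max => /andP[th0 thk].
have bR : 0 < b%:R :> R by rewrite ltr0n.
have qR : 0 < q%:R :> R by rewrite ltr0n.
have le_ba : (b <= a)%N.
  rewrite -(ler_nat R) -[leLHS]mul1r -ler_pdivlMr // -rhoE.
  by rewrite -[leLHS](powRr0 2) ler_pow2 ltW.
have lt_a2b : (a < 2 * b)%N.
  by rewrite -(ltr_nat R) natrM -ltr_pdivrMr // -rhoE -[ltRHS]powRr1 // ltr_pow2.
pose d w := capital (R:=R) g a b w * (2 `^ (s' - 1)) ^+ size w.
have rE' : 2 `^ (s' - 1) = p%:R / (2 * q)%:R :> R.
  by rewrite pow2D powR_inv1 // rE natrM; field; rewrite gt_eqF.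
pose gd w t : rat := (p ^ size w * \sum_(j < 2 ^ t) payoff_num g a b (w ++ bits t j) t)%:R /
  (2 ^ t * (b ^ t * (2 * q) ^ size w))%:R.
have gdE w t : ratr (gd w t) = stage (R:=R) g a b t w * (2 `^ (s' - 1)) ^+ size w.
  rewrite /gd fmorph_div /= !ratr_nat !natrM !natrX rE' /stage avg_bits natr_sum.
  rewrite /payoff -mulr_suml expr_div_n natrM.
  by field; rewrite !expf_neq0 ?mulf_neq0 ?gt_eqF.
have e0' n : 0 <= (2 `^ (s' - 1)) ^+ n :> R by rewrite exprn_ge0 // powR_ge0.
exists s'; first by rewrite (le_trans s0) ltW.
exists d; split.
- exists gd; split.
  + exact: computable_payoff.
  + move=> w t; rewrite -(ler_rat R) rmorph0 gdE mulr_ge0 //.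
    by apply: stage_ge0.
  + move=> w t; rewrite -(ler_rat R) !gdE ler_wpM2r //.
    by apply: (stage_nd g_nd b0 le_ba).
  + move=> w t; rewrite gdE ler_wpM2r //.
    exact: (stage_le_capital g_nd g_le l_small b0 le_ba lt_a2b).
  + move=> w; rewrite (_ : (fun t => _) = (fun t => stage (R:=R) g a b t w *
      (2 `^ (s' - 1)) ^+ size w)); last by apply/funext => t; rewrite gdE.
    apply: cvgMl; exact: (cvg_stage g_nd g_le l_small b0 le_ba lt_a2b).
- split=> w.
    by rewrite mulr_ge0 //; exact: (capital_ge0 g_nd g_le l_small b0 le_ba lt_a2b).
  apply/eq_gale; rewrite /d !size_rcons exprS -mulrDl.
  rewrite -(martingale_capital g_nd g_le l_small b0 le_ba lt_a2b w).
  by rewrite pow2D powR_inv1 //; field.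
move=> X [_ _ limX].
have [N NP] : exists N, forall n, (N <= n)%N -> 1 - s - k < AVG (R:=R) l (prefix X n).
  have /lt_limn_einf [N NP] : ((1 - s - k)%:E < limn_einf (fun n => (AVG (R:=R) l (prefix X n))%:E))%E.
    by apply: lt_le_trans limX; rewrite lte_fin gtrBl.
  by exists N => n /NP; rewrite lte_fin.
have dk n : (0 < n)%N -> (N <= n)%N -> 2 `^ (k * n%:R) <= d (prefix X n).
  move=> n0 /NP; rewrite AVGE size_prefix_seq ltr_pdivlMr ?ltr0n // => H.
  rewrite /d size_prefix_seq.
  have := capital_ge g_nd g_le g_cvg l_small b0 le_ba lt_a2b (w := prefix X n).
  rewrite size_prefix_seq => /(_ n0); rewrite -rhoE -pow2M => cap.
  apply: le_trans (ler_wpM2r (e0' n) cap); rewrite -pow2M -pow2D ler_pow2.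
  have Nn : (yes_count l (prefix X n) <= n.+1)%N.
    rewrite /yes_count size_prefix_seq -[leqRHS]card_ord -sum1_card.
    by apply: leq_sum => i _; case: (l _).
  have n1 : 1 <= n%:R :> R by rewrite ler1n.
  move: Nn; rewrite -(ler_nat R) -natr1; move: H.
  set c : R := (yes_count _ _)%:R; have c0 : 0 <= c by rewrite ler0n.
  move=> H1 H2.
  have h1 : 0 <= (th - (1 - k)) * c by rewrite mulr_ge0 // subr_ge0 ltW.
  have h2 : 0 <= k * (n%:R + 1 - c) by rewrite mulr_ge0 ?subr_ge0 // ltW.
  have h3 : 0 <= k * (n%:R - 1) by rewrite mulr_ge0 ?subr_ge0 // ltW.
  have s'E : s' = s + 4 * k by rewrite /k; field.
  by rewrite s'E; lra.
(* Since [pow2_ge] bounds the power below by [k * n * ln 2], the value [M] is attained once [n]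
   exceeds [M / (k * ln 2)]. *)
apply/eqyP => M M0; pose N' := maxn N.+1 (Num.trunc (M / (k * ln 2))).+1.
apply: (@le_limn_einf _ _ _ N') => n; rewrite geq_max => /andP[Nn Mn].
rewrite lee_fin; apply: le_trans (dk n _ (ltnW Nn)); last by case: (n) Nn.
apply: le_trans (pow2_ge _); rewrite mulrAC -ler_pdivrMl; last exact: mulr_gt0 k0 ln2_gt0.
rewrite mulrC; apply: ltW; apply: lt_le_trans (truncnS_gt _) _.
by rewrite ler_nat.
Qed.

(** * From gales to learners *)

Lemma le_lambda (R : realType) (A B : set (nat -> bool)) :
  A `<=` B -> (lambda (R:=R) A <= lambda (R:=R) B)%E.
Proof.
move=> AB; apply/ereal_infP => _ [ws [Bws ->]]; apply: ereal_inf_lbound.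
by exists ws; split => //; exact: subset_trans Bws.
Qed.

Lemma lambda_le1 (R : realType) (A : set (nat -> bool)) : (lambda (R:=R) A <= 1%:E)%E.
Proof.
apply: (@lambda_le _ _ (pred1 [::])) => [[|u [|v F]]|Y _].
- by rewrite big_nil.
- by move=> _ /= /andP[/eqP -> _]; rewrite big_seq1 expr0 invr1.
- by move=> /= /andP[uv _] /and3P[/eqP u0 /eqP v0 _]; rewrite u0 v0 mem_head in uv.
- by exists [::].
Qed.

Section LearnerOfGale.
Context {R : realType}.
Variables (m : seq bool -> R).
Hypotheses (m_super : supermartingale m) (m_ge0 : forall w, 0 <= m w)
  (m_nil : m [::] <= 1).

(** By [hit_size] no power beyond those counted can be exceeded, so cutting the sum at [size w]
    loses nothing. *)
Definition level w : nat := \sum_(n < size w) hit m (2 ^+ n.+1) w.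
(** Answers yes when the last bit raised the level. The empty string is compared with itself and
    gets the answer no. *)
Definition learner w : bool := (level (take (size w).-1 w) < level w)%N.

Lemma le_double w b : m (rcons w b) <= 2 * m w.
Proof.
have := m_super w; have := m_ge0 (rcons w true); have := m_ge0 (rcons w false).
by case: b; lra.
Qed.

Lemma m_le_exp w : m w <= 2 ^+ size w.
Proof.
elim/last_ind: w => [|w b IH]; first by rewrite expr0.
by apply: le_trans (le_double w b) _; rewrite size_rcons exprS ler_pM2l.
Qed.

Lemma hit_mono w j k : (j <= k)%N -> hit m (2 ^+ k) w -> hit m (2 ^+ j) w.
Proof.
move=> jk /hitP[i iw kmi]; apply/hitP; exists i => //.
by apply: le_lt_trans kmi; rewrite ler_eXn2l // ltr1n.
Qed.

Lemma hit_size w k : hit m (2 ^+ k) w -> (k < size w)%N.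
Proof.
move=> /hitP[i iw kmi]; rewrite -(@ltr_eXn2l R 2) ?ltr1n //.
apply: lt_le_trans kmi _; apply: le_trans (m_le_exp _) _.
by rewrite ler_eXn2l ?ltr1n // size_takel.
Qed.

Lemma hit_parent w b k : hit m (2 ^+ k.+1) (rcons w b) -> hit m (2 ^+ k) w.
Proof.
rewrite hit_rcons => /orP[|]; first exact: hit_mono.
move=> /lt_le_trans /(_ (le_double w b)); rewrite exprS ltr_pM2l // => kw.
by apply/hitP; exists (size w); rewrite // take_size.
Qed.

Lemma level_le_rcons w b : (level w <= level (rcons w b))%N.
Proof.
rewrite /level size_rcons big_ord_recr /= (leq_trans _ (leq_addr _ _)) //.
by apply: leq_sum => n _; rewrite hit_rcons; case: (hit _ _ w).
Qed.

(** Exceeding [2 ^+ n.+2] at a child forces [2 ^+ n.+1] at the parent; after dropping the first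
    summand, the sums compare termwise. *)
Lemma level_rcons_le w b : (level (rcons w b) <= (level w).+1)%N.
Proof.
rewrite {1}/level size_rcons big_ord_recl -[leqRHS]add1n leq_add //; first by case: (hit _ _ _).
apply: leq_sum => n _; rewrite lift0.
by case E: (hit _ _ (rcons w b)) => //; rewrite (hit_parent E).
Qed.

(** The level starts at 0 and rises by 0 or 1 at each bit, so counting its rises telescopes. *)
Lemma yes_count_learner w : yes_count learner w = level w.
Proof.
elim/last_ind: w => [|w b IH].
  by rewrite /yes_count big_ord1 /learner /level /= !big_ord0.
rewrite /yes_count size_rcons big_ord_recr /= take_oversize ?size_rcons //.
have -> : (\sum_(i < (size w).+1) learner (take i (rcons w b)) = yes_count learner w)%N.
  by apply: eq_bigr => i _; rewrite -cats1 takel_cat // -ltnS.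
rewrite IH /learner size_rcons /= -cats1 take_size_cat // cats1.
have := level_le_rcons w b; have := level_rcons_le w b.
by case: ltngtP => //=; lia.
Qed.

(** The exceeded powers are closed downwards, so the level is the largest exponent among them. *)
Lemma level_geP w k : (0 < k)%N -> (k <= level w)%N = hit m (2 ^+ k) w.
Proof.
move=> k0; apply/idP/idP => [kl|hk]; last first.
  have e : minn (size w) k = k by apply/minn_idPr; exact/ltnW/hit_size.
  rewrite -{1}e -sum_ltn_minn; apply: leq_sum => n _.
  by case: ltnP => // nk; rewrite (hit_mono nk hk).
apply: contraLR kl => nhk; rewrite -ltnNge -(prednK k0) ltnS.
apply: leq_trans (geq_minr (size w) k.-1); rewrite -sum_ltn_minn.
apply: leq_sum => n _; case E: (hit _ _ w) => //.
have -> // : (n < k.-1)%N; rewrite ltnNge; apply: contra nhk => kn.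
by apply: hit_mono E; rewrite -(prednK k0) ltnS.
Qed.

Lemma lambda_learner n : (lambda (R:=R) (many_yes learner n) <= ((2:R) ^- n)%:E)%E.
Proof.
(* [level_geP] speaks of positive exponents only; for 0 the bound is the total measure. *)
case: n => [|n]; first by rewrite expr0 invr1; exact: lambda_le1.
have c0 : 0 < 2 ^+ n.+1 :> R by rewrite exprn_gt0.
have := lambda_hit m_super m_ge0 c0.
move=> h; apply: (@le_trans _ _ (m [::] / 2 ^+ n.+1)%:E); last first.
  by rewrite lee_fin -[leRHS]mul1r ler_pM2r ?invr_gt0.
apply: le_trans _ h; apply: le_lambda => Y /count_of_many_yes[i].
rewrite yes_count_learner level_geP // => /hitP[j]; rewrite size_prefix_seq => ji.
by rewrite take_prefix_seq // => nj; exists j.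
Qed.

End LearnerOfGale.

Lemma learner_of_gale (R : realType) (s e : R) (d : seq bool -> R) : 0 <= s -> 0 < e ->
  lower_semicomputable d -> is_gale s d ->
  exists2 s', 0 <= s' <= s + e &
    exists l, forall X, succeeds_strongly d X -> strongly_learns s' l X.
Proof.
move=> s0 e0 [g [g_comp g0 g_nd g_le g_cvg]] [d0 galeE].
have sse : s < s + e by rewrite ltrDl.
have [p [q [s' /andP[ss' s'e] [p0 q0 rE]]]] := pow2_rat_dense sse.
exists s'; first by rewrite (le_trans s0) ltW.
(* Dividing by [2 ^+ K] brings the initial capital down to at most 1, and a power of two merges with
   the thresholds [2 ^+ n.+1]. *)
have [K dK] : exists K, d [::] <= 2 ^+ K.
  exists (Num.trunc (d [::])).+1; apply: le_trans (ltW (truncnS_gt _)) _.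
  by rewrite -natrX ler_nat ltnW // ltn_expl.
pose x : R := 2 `^ (1 - s').
have x0 : 0 < x by rewrite powR_gt0.
have xE : x = (2 * q)%:R / p%:R.
  rewrite /x pow2D powRN rE powRr1 // natrM; field.
  by rewrite !pnatr_eq0 -!lt0n p0 q0.
have K0 : 0 < 2 ^+ K :> R by rewrite exprn_gt0.
pose m w := d w * x ^+ size w / 2 ^+ K.
have m0 w : 0 <= m w by rewrite !mulr_ge0 // ?invr_ge0 ?exprn_ge0 // ltW.
have msup : supermartingale m.
  move=> w; rewrite /m !size_rcons -!mulrDl exprS.
  have <- := (eq_gale s d w).1 (galeE w).
  (* The factor split off is 2 to the power [s - s'], which is below 1. *)
  rewrite (_ : _ / 2 = (2 `^ s * x / 2) * (d w * x ^+ size w / 2 ^+ K)); last first.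
    by field; rewrite gt_eqF.
  apply: ler_piMl; first exact: (m0 w).
  rewrite ler_pdivrMr // mul1r -pow2D -[leRHS]powRr1 // ler_pow2.
  by rewrite addrCA gerDl subr_le0 ltW.
have mnil : m [::] <= 1 by rewrite /m expr0 mulr1 ler_pdivrMr // mul1r.
have hitE w n : reflect (exists2 i, (i <= size w)%N &
    (2 ^ (K + n.+1) * p ^ i)%N%:R < d (take i w) * ((2 * q) ^ i)%N%:R) (hit m (2 ^+ n.+1) w).
  have eqv i : (i <= size w)%N -> (2 ^+ n.+1 < m (take i w)) =
      ((2 ^ (K + n.+1) * p ^ i)%N%:R < d (take i w) * ((2 * q) ^ i)%N%:R).
    move=> iw; rewrite /m size_takel // ltr_pdivlMr // xE expr_div_n mulrA.
    rewrite ltr_pdivlMr ?exprn_gt0 ?ltr0n //.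
    by rewrite -exprD addnC [in RHS](natrM _ (2 ^ _)) !natrX.
  apply: (iffP (hitP _ _ _)) => -[i iw]; first by rewrite eqv //; exists i.
  by rewrite -eqv //; exists i.
pose E w t n := exceeds g K p q w t n.
have EP w t n : reflect (exists2 i, (i <= size w)%N &
    (2 ^ (K + n.+1) * p ^ i)%N%:R < ratr (g (take i w) t) * ((2 * q) ^ i)%N%:R :> R) (E w t n).
  have rt i : ((2 ^ (K + n.+1) * p ^ i)%N%:R < ratr (g (take i w) t) * ((2 * q) ^ i)%N%:R :> R) =
      ((2 ^ (K + n.+1) * p ^ i)%N%:R < g (take i w) t * ((2 * q) ^ i)%N%:R).
    by rewrite -(ltr_rat R) [ratr (_ * _)]rmorphM /= !ratr_nat.
  apply: (iffP existsP) => [[i]|[i iw]]; first by rewrite -rt; exists i => //; rewrite -ltnS.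
  by rewrite rt => h; exists (Ordinal (iw : (i < (size w).+1)%N)).
have EE w t n : E w t n -> E w t.+1 n.
  move=> /EP[i iw h]; apply/EP; exists i => //; apply: lt_le_trans h _.
  by rewrite ler_wpM2r // ler_rat.
have Ehit w t n : E w t n -> hit m (2 ^+ n.+1) w.
  move=> /EP[i iw h]; apply/hitE; exists i => //; apply: lt_le_trans h _.
  by rewrite ler_wpM2r.
(* The inequality defining a hit is strict, so [g] certifies it from some stage on. *)
have hitEv w n : hit m (2 ^+ n.+1) w -> exists t0, forall t, (t0 <= t)%N -> E w t n.
  move=> /hitE[i iw h].
  have q2 : 0 < ((2 * q) ^ i)%N%:R :> R by rewrite ltr0n expn_gt0 muln_gt0 q0.
  have := @g_cvg (take i w); move/cvgrPdist_lt.
  move: h; rewrite -ltr_pdivrMr // -subr_gt0 => h /(_ _ h) [t0 _ t0P].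
  exists t0 => t /t0P /=; rewrite ger0_norm ?subr_ge0 // ltrD2l ltrN2 ltr_pdivrMr // => h'.
  by apply/EP; exists i.
have AVGl w : AVG (R:=R) (learner m) w = (level m w)%:R / (size w)%:R.
  by rewrite AVGE yes_count_learner.
exists (learner m) => X dX; split; [|exact: lambda_learner|]; last first.
  (* Eventually [d] exceeds [2 ^+ K], so [m] exceeds [x ^+ n] and, when [1 - s'] is nonnegative, the
     level is at least the integer part of [(1 - s') * n]. Rounding costs at most 1 / n, which [N']
     keeps within [eps]. *)
  have : ((2 ^+ K)%:E < limn_einf (fun n => (d (prefix X n))%:E))%E by rewrite dX ltry.
  move=> /lt_limn_einf[N NP]; apply/lee_addgt0Pr => eps eps0.
  rewrite -leeBlDr // -EFinB; pose N' := maxn N.+1 (Num.trunc eps^-1).+1.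
  apply: (@le_limn_einf _ _ _ N') => n; rewrite geq_max => /andP[Nn epsn].
  rewrite lee_fin AVGl size_prefix_seq.
  have n0 : 0 < n%:R :> R by rewrite ltr0n; case: (n) Nn.
  have [s'1|s'1] := ltP (1 - s') 0.
    by apply: (@le_trans _ _ 0); [lra | rewrite divr_ge0].
  have mn : x ^+ n < m (prefix X n).
    rewrite /m size_prefix_seq ltr_pdivlMr // mulrC ltr_pM2r ?exprn_gt0 //.
    by have := NP n (ltnW Nn); rewrite lte_fin.
  have /truncn_itv/andP[] : 0 <= (1 - s') * n%:R by rewrite mulr_ge0.
  set k := Num.trunc _ => kle klt.
  have kl : (k <= level m (prefix X n))%N.
    have [->//|k0] := posnP k; rewrite level_geP //; apply/hitP; exists n.
      by rewrite size_prefix_seq.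
    rewrite take_prefix_seq //; apply: le_lt_trans mn.
    by rewrite /x -pow2M -powR_mulrn // ler_pow2.
  rewrite ler_pdivlMr //; move: kl; rewrite -(ler_nat R) => kl.
  have en : 1 <= eps * n%:R.
    rewrite -ler_pdivrMl // mulr1; apply: ltW; apply: lt_le_trans (truncnS_gt _) _.
    by rewrite ler_nat.
  by rewrite -natr1 in klt; lra.
pose gl w t : rat := (\sum_(n < size w) E w t n)%:R / (size w)%:R.
exists gl; split.
- exact: computable_exceeds.
- by move=> w t; rewrite divr_ge0.
- move=> w t; rewrite ler_wpM2r ?invr_ge0 // ler_nat; apply: leq_sum => n _.
  by case h: (E w t n) => //; rewrite EE.
- move=> w t; rewrite AVGl fmorph_div /= !ratr_nat ler_wpM2r ?invr_ge0 // ler_nat.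
  by apply: leq_sum => n _; case h: (E w t n) => //; rewrite (Ehit _ _ _ h).
- move=> w; rewrite AVGl (_ : (fun t => _) = (fun t => (\sum_(n < size w) (E w t n)%:R) / (size w)%:R)); last first.
    by apply/funext => t; rewrite fmorph_div /= !ratr_nat natr_sum.
  (* The count converges termwise: each indicator is constantly 0 or eventually 1. *)
  apply: cvgMl; rewrite natr_sum; apply: cvg_big => [|n _]; first exact: add_continuous.
  case h: (hit _ _ _); last first.
    rewrite (_ : (fun t => _) = cst 0); first exact: cvg_cst.
    by apply/funext => t; case h': (E w t n) => //; rewrite (Ehit _ _ _ h') in h.
  have [t0 t0P] := hitEv _ _ h.
  by apply: cvg_near_cst; exists t0 => // t /= /t0P ->.
Qed.

(** * The zero gale and the equality of the two infima *)

Lemma lower_semicomputable0 (R : realType) : lower_semicomputable (fun=> 0 : R).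
Proof.
exists (fun _ _ => 0); split=> // [||w].
- by apply/computable_wn_ratP; exact: comp_const.
- by move=> w t; rewrite rmorph0.
- by rewrite rmorph0; exact: cvg_cst.
Qed.

Lemma is_gale0 (R : realType) (s : R) : is_gale s (fun=> 0).
Proof. by split=> // w; rewrite !mul0r addr0. Qed.

Theorem mainTheorem9 (R : realType) (Gamma : classical_sets.set (nat -> bool)) :
  Dim (R:=R) Gamma = reals.inf (G_str_constr (R:=R) Gamma).
Proof.
apply: inf_eq_of_approx => [s []|s []|s e [s0 [d [d_lsc d_gale dG]]] e0|s e [s0 [l lG]] e0] //.
  have [s' /andP[s'0 s'e] [l lP]] := learner_of_gale s0 e0 d_lsc d_gale.
  by exists s' => //; split=> //; exists l => X /dG /lP.
(* The properties of [l] itself are asserted only along with some [X] in [Gamma]. One such [X]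
   provides them for the whole class; if there is none, the zero gale does. *)
have [[X GX]|Gn] := pselect (Gamma !=set0); last first.
  exists s; last by rewrite lerDl ltW.
  split=> //; exists (fun=> 0); split=> [||X GX].
  - exact: lower_semicomputable0.
  - exact: is_gale0.
  - by case: Gn; exists X.
have [l_lsc l_small _] := lG X GX.
have [s' /andP[s'0 s'e] [d [d_lsc d_gale dP]]] := gale_of_learner s0 e0 l_lsc l_small.
exists s' => //; split=> //; exists d; split=> // Y /lG; exact: dP.
Qed.
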